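(* There is a (deterministic) algorithm which, given as input a 3-uniform hypergraph $H$ with $n \geq 4$ vertices and $m$ edges that admits an LO 2-colouring, finds an LO colouring of $H$ with at most $\log_2(n)$ colours in time $O(n^3 + nm)$.
   Context: A hypergraph $H$ consists of a finite vertex set and a finite set of edges, each edge being a set of vertices; $H$ is 3-uniform if every edge consists of exactly 3 vertices. A linearly ordered (LO) $k$-colouring of $H$ is an assignment to each vertex of a colour from $\{0,1,\ldots,k-1\}$ such that every edge has a unique maximum colour, i.e. the maximum colour appearing in the edge is attained by exactly one vertex of the edge. (For 3-uniform hypergraphs: if two vertices of an edge have the same colour, then the third vertex of the edge has a strictly larger colour.) The algorithm is given only $H$, with the promise that an LO 2-colouring of $H$ exists; it is not given such a colouring. *)

(* Defs.v *)
From mathcomp Require Import all_boot.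

Set Implicit Arguments.
Unset Strict Implicit.
Unset Printing Implicit Defensive.

Notation hypergraph V := {set {set V}}.

Definition uniform (V : finType) (r : nat) (H : hypergraph V) : Prop :=
  forall e : {set V}, e \in H -> #|e| = r.

Definition LO_colouring (V : finType) (k : nat) (H : hypergraph V)
    (c : V -> 'I_k) : Prop :=
  forall e : {set V}, e \in H ->
    #|[set v in e | nat_of_ord (c v) == \max_(u in e) c u]| = 1.

Definition LO_colourable (V : finType) (k : nat) (H : hypergraph V) : Prop :=
  exists c : V -> 'I_k, LO_colouring H c.

(** * Word RAM

    Algorithms are while-programs over a random access machine whose registers
    and memory cells hold [w]-bit words.  The word length [w] is a parameter of
    the execution and is not accessible to the program. *)

Inductive binop : Type := OpAdd | OpSub | OpMul | OpEq | OpLt.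

Inductive expr : Type :=
| Const of nat
| Reg of nat
| Fetch of expr
| Bin of binop & expr & expr.

Inductive cmd : Type :=
| Skip
| SetReg of nat & expr
| Store of expr & expr
| Seq of cmd & cmd
| If of expr & cmd & cmd
| While of expr & cmd.

Record state : Type := State { reg : nat -> nat; ram : nat -> nat }.

Definition upd (f : nat -> nat) (a x : nat) : nat -> nat :=
  fun b => if b == a then x else f b.

Definition word (w x : nat) : nat := x %% 2 ^ w.

(** Addition and multiplication wrap around modulo [2 ^ w]; subtraction is
    truncated at 0; comparisons return 0 or 1. *)
Definition eval_op (w : nat) (o : binop) (x y : nat) : nat :=
  match o with
  | OpAdd => word w (x + y)
  | OpSub => word w (x - y)
  | OpMul => word w (x * y)
  | OpEq => word w (x == y)
  | OpLt => word w (x < y)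
  end.

Fixpoint eval (w : nat) (s : state) (e : expr) : nat :=
  match e with
  | Const x => word w x
  | Reg r => reg s r
  | Fetch a => ram s (eval w s a)
  | Bin o e1 e2 => eval_op w o (eval w s e1) (eval w s e2)
  end.

Fixpoint cost (e : expr) : nat :=
  match e with
  | Const _ | Reg _ => 1
  | Fetch a => (cost a).+1
  | Bin _ e1 e2 => (cost e1 + cost e2).+1
  end.

(** [exec w p s t s']: started in [s], the program [p] halts in [s'] after
    exactly [t] unit-cost operations. *)
Inductive exec (w : nat) : cmd -> state -> nat -> state -> Prop :=
| ExecSkip s : exec w Skip s 1 s
| ExecSetReg s r e :
    exec w (SetReg r e) s (cost e).+1
      (State (upd (reg s) r (eval w s e)) (ram s))
| ExecStore s a e :
    exec w (Store a e) s (cost a + cost e).+1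
      (State (reg s) (upd (ram s) (eval w s a) (eval w s e)))
| ExecSeq p q s t s1 t1 s2 :
    exec w p s t s1 -> exec w q s1 t1 s2 -> exec w (Seq p q) s (t + t1) s2
| ExecIfTrue e p q s t s1 :
    eval w s e != 0 -> exec w p s t s1 ->
    exec w (If e p q) s (cost e + t).+1 s1
| ExecIfFalse e p q s t s1 :
    eval w s e = 0 -> exec w q s t s1 ->
    exec w (If e p q) s (cost e + t).+1 s1
| ExecWhileDone e p s :
    eval w s e = 0 -> exec w (While e p) s (cost e).+1 s
| ExecWhileStep e p s t s1 t1 s2 :
    eval w s e != 0 -> exec w p s t s1 -> exec w (While e p) s1 t1 s2 ->
    exec w (While e p) s (cost e + t + t1).+1 s2.

Lemma exec_deterministic (w : nat) (p : cmd) (s : state) (t : nat) (s1 : state)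
    (t' : nat) (s2 : state) :
  exec w p s t s1 -> exec w p s t' s2 -> t = t' /\ s1 = s2.
Proof.
move=> E; elim: E t' s2 => {p s t s1}; intros;
  match goal with E : exec _ _ _ ?t' ?s' |- _ = ?t' /\ _ = ?s' =>
    inversion E; subst end;
  repeat match goal with
  | IH : (forall t' s', exec w ?p ?s t' s' -> _), E : exec w ?p ?s _ _ |- _ =>
      case: (IH _ _ E) => ? ?; subst; clear E
  | H0 : eval ?v ?s ?e = 0, H1 : is_true (eval ?v ?s ?e != 0) |- _ =>
      by rewrite H0 in H1
  end; by [].
Qed.

(** * Input and output conventions *)

Notation triple n := ('I_n * 'I_n * 'I_n)%type.

Definition edge_of (n : nat) (x : triple n) : {set 'I_n} :=
  [set x.1.1; x.1.2; x.2].

(** [xs] lists every edge of [H] exactly once, the edges and the vertices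
    within each edge being in arbitrary order. *)
Definition edge_listing (n : nat) (H : hypergraph 'I_n) (xs : seq (triple n)) :
    Prop :=
  perm_eq [seq edge_of x | x <- xs] (enum H).

(** Cell 0 holds the number of vertices, cell 1 the number of edges, and cells
    [2 + 3 * i], [3 + 3 * i], [4 + 3 * i] the vertices of the [i]-th edge. *)
Definition input_data (n : nat) (xs : seq (triple n)) : seq nat :=
  [:: n, size xs & flatten
     [seq [:: nat_of_ord x.1.1; nat_of_ord x.1.2; nat_of_ord x.2] | x <- xs]].

Definition initial_state (n : nat) (xs : seq (triple n)) : state :=
  State (fun=> 0) (fun a => nth 0 (input_data xs) a).

(** The colour of vertex [v] is returned in cell [v]. *)
Definition returns_colouring (n k : nat) (s : state) (c : 'I_n -> 'I_k) : Prop :=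
  forall v : 'I_n, ram s v = c v.

(* Main.v *)
Require Import Defs.
From mathcomp Require Import all_boot.
From mathcomp Require Import zify.

(** An LO 2-colouring of a 3-uniform hypergraph is a 0/1 vector [x] with
    exactly one 1 on every edge [{a, b, c}], so over the field with two elements
    it solves the linear system [x a + x b + x c = 1].  The algorithm only uses
    this system and a final search of constant size.

    Elimination.  Every vertex carries an affine form in [n] parameters, at the
    start the form of vertex [v] is the parameter [v].  An edge whose three forms
    do not add up to 1 gives a relation between parameters, and one of them is
    substituted away.  Testing an edge takes time [O(n)]; a substitution takes
    [O(n^2)], and it removes a parameter for good ([nonzero_columns_eliminate]),
    so the total is [O(n^3 + n m)].  In the end every value of the parameters
    gives a vector of odd parity on each edge ([affine_parity]), that is one or
    three 1s, and [x] is obtained by giving the parameters the values [x]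
    ([affine_solved]).  In particular a vertex whose form is constant has that
    constant as its value in [x] ([pivot_forced]).

    Rounds.  All vertices start active.  In round [r] a solution is chosen, the
    active vertices where it is 0 receive colour [r] and retire, and the others
    stay active.  By parity an edge of three active vertices either stays
    active as a whole, or two of its vertices retire with the same colour while
    the third gets a larger colour later: the edge then has a unique maximum
    whatever comes next ([settled_step]).  The parameters are fixed one after the
    other; the vertices for which a given parameter is the last one in their form
    are all decided by it, and one of its two values sends at least half of them
    to 0 ([greedy_half]).  Hence each round at least halves the number of active
    vertices with a non-constant form.

    Last two colours.  Rounds go on while more than 7 such vertices are active.
    A round that starts with at least 8 of them after [r] earlier rounds shows
    [8 * 2 ^ r <= n], so with [n >= 4] one has [2 ^ (r + 2) <= n] at the end, and
    colours [r] and [r + 1] may still be used on the active vertices.  Colouring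
    an active vertex [v] by [r + x v] is correct ([winning_bits]).  The value [x v]
    is known where the form is constant, and the at most 7 other bits are
    found by trying all of them and checking the resulting colouring on every
    edge.  One more halving round in place of the search could leave three active
    vertices that form an edge, with a single colour for them.

    Machine.  A weakest-precondition calculus for the word RAM, with the elapsed
    time as a ghost variable, sees memory as a two-dimensional table and
    discharges overflow and aliasing once and for all ([wp], [addr_inj]).  Each
    part of the program is then proved to compute the corresponding function of
    the first part. *)

Set Implicit Arguments.
Unset Strict Implicit.
Unset Printing Implicit Defensive.

(** * Solutions of the parity system and the rounds of the colouring *)

Fixpoint last_true (r : nat -> bool) (d k : nat) : nat :=
  if k is k'.+1 then if r k' then k' else last_true r d k' else d.

Variant last_true_spec (r : nat -> bool) (d k : nat) : nat -> Prop :=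
| LastTrueNone of (forall j, j < k -> r j = false) : last_true_spec r d k d
| LastTrueSome p of p < k & r p & (forall j, j < k -> p < j -> r j = false) :
    last_true_spec r d k p.

Lemma last_trueP r d k : last_true_spec r d k (last_true r d k).
Proof.
elim: k => [|k IH] /=; first by apply: LastTrueNone.
case: ifP => rk; first by apply: LastTrueSome => // j; lia.
case: IH => [h|p pk rp h].
  by apply: LastTrueNone => j; rewrite ltnS leq_eqVlt => /orP[/eqP->|/h].
apply: LastTrueSome => // [|j]; first by lia.
by rewrite ltnS leq_eqVlt => /orP[/eqP->|/h].
Qed.

Section Elimination.

Variable n : nat.

Implicit Types (A : nat -> nat -> bool) (x y : nat -> bool).

(** A row [r] of length [n + 1] stands for the affine form with constant term
    [r n] and coefficients [r j] for [j < n], over the two-element field. *)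
Definition affine (r : nat -> bool) (y : nat -> bool) : bool :=
  r n (+) \big[addb/false]_(j < n) (r j && y j).

(** The form [A a + A b + A c + 1]: the equation of the edge [{a, b, c}] says that
    it vanishes. *)
Definition residual A (a b c j : nat) : bool :=
  A a j (+) A b j (+) A c j (+) (j == n).

(** Substitution of the parameter [p] by the other terms of [r], for a form [r]
    that is required to vanish and contains [p]: adding [r] cancels [p]. *)
Definition eliminate (r : nat -> bool) (p : nat) A (v j : nat) : bool :=
  A v j (+) (A v p && r j).

Definition impose A (a b c : nat) : nat -> nat -> bool :=
  let r := residual A a b c in
  let p := last_true r n n in
  if p < n then eliminate r p A else A.

Lemma affine_add r1 r2 y :
  affine (fun j => r1 j (+) r2 j) y = affine r1 y (+) affine r2 y.
Proof.
rewrite /affine addbACA; congr (_ (+) _).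
by rewrite -big_split /=; apply: eq_bigr => j _; rewrite andb_addl.
Qed.

Lemma eq_affine r1 r2 y :
  (forall j, j <= n -> r1 j = r2 j) -> affine r1 y = affine r2 y.
Proof.
move=> h; rewrite /affine h //; congr (_ (+) _).
by apply: eq_bigr => j _; rewrite h // ltnW.
Qed.

Lemma affine_scale (b : bool) r y :
  affine (fun j => b && r j) y = b && affine r y.
Proof.
case: b => /=; first by apply: eq_affine.
by rewrite /affine big1.
Qed.

Lemma affine_const y : affine (fun j => j == n) y.
Proof.
rewrite /affine eqxx big1 // => j _.
by rewrite [_ == n]ltn_eqF.
Qed.

Lemma affine_residual A a b c y :
  affine (residual A a b c) y =
  ~~ (affine (A a) y (+) affine (A b) y (+) affine (A c) y).
Proof. by rewrite /residual !affine_add affine_const addbT. Qed.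

(** Forms only change by multiples of the residual, so their values are kept at
    every vector of parameters where the residual vanishes, in particular at the
    hidden colouring. *)
Lemma affine_impose A a b c x v :
  affine (residual A a b c) x = false ->
  affine (impose A a b c v) x = affine (A v) x.
Proof.
move=> r0; rewrite /impose; case: ifP => // _.
by rewrite /eliminate affine_add affine_scale r0 andbF addbF.
Qed.

(** Without a pivot the residual is a constant, and the existence of a solution
    [x] forces this constant to be 0; with a pivot, substitution turns the residual
    [r] into [r + r]. *)
Lemma residual_impose A a b c x :
  affine (residual A a b c) x = false ->
  forall j, j <= n -> residual (impose A a b c) a b c j = false.
Proof.
move=> r0 j jn; rewrite /impose; case: last_trueP => [h|p pn rp _].
  rewrite ltnn; move: jn; rewrite leq_eqVlt => /orP[/eqP->|/h//].
  move: r0; rewrite /affine big1 ?addbF // => i _; by rewrite h.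
rewrite pn; have pn' : (p == n) = false by lia.
move: rp; rewrite /residual /eliminate pn' addbF.
by case: (A a p) (A b p) (A c p) (A a j) (A b j) (A c j) (j == n)
  => [] [] [] [] [] [] [].
Qed.

(** Elimination acts linearly on forms, so equations that already hold
    identically keep doing so. *)
Lemma residual_eliminate A r p a b c :
  p < n -> (forall j, j <= n -> residual A a b c j = false) ->
  forall j, j <= n -> residual (eliminate r p A) a b c j = false.
Proof.
move=> pn h j jn; have := h j jn; have := h p (ltnW pn).
have pn' : (p == n) = false by lia.
rewrite /residual /eliminate pn' addbF.
by case: (A a p) (A b p) (A c p) (A a j) (A b j) (A c j) (j == n) (r j)
  => [] [] [] [] [] [] [] [].
Qed.

(** The parameters that still occur; their number is the potential that pays
    for the eliminations. *)
Definition nonzero_columns A : nat :=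
  #|[set j : 'I_n | [exists v : 'I_n, A v j]]|.

Lemma nonzero_columns_le A : nonzero_columns A <= n.
Proof. by rewrite /nonzero_columns -[X in _ <= X]card_ord max_card. Qed.

Lemma nonzero_columns_eliminate A a b c (r := residual A a b c) p :
  a < n -> b < n -> c < n -> p < n -> r p ->
  nonzero_columns (eliminate r p A) < nonzero_columns A.
Proof.
move=> an bn cn pn rp; apply: proper_card; apply/properP; split.
  apply/subsetP => j; rewrite !inE => /existsP[v].
  rewrite /eliminate => h; apply: contraTT h => /existsPn z.
  rewrite /r /residual (negbTE (z v)) (negbTE (z (Ordinal an))).
  rewrite (negbTE (z (Ordinal bn))) (negbTE (z (Ordinal cn))) /=.
  by rewrite (_ : (_ == n) = false) ?andbF //; have := ltn_ord j; lia.
exists (Ordinal pn); rewrite inE /=.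
  have pn' : (p == n) = false by lia.
  move: rp; rewrite /r /residual pn' addbF => rp.
  case ha : (A a p); first by apply/existsP; exists (Ordinal an).
  case hb : (A b p); first by apply/existsP; exists (Ordinal bn).
  case hc : (A c p); first by apply/existsP; exists (Ordinal cn).
  by rewrite ha hb hc in rp.
apply/existsPn => v; rewrite /eliminate rp andbT.
by case: (A v p).
Qed.

Variables (m : nat) (ea eb ec : nat -> nat).
Hypothesis edges_lt : forall i, i < m -> [/\ ea i < n, eb i < n & ec i < n].

Fixpoint solved (i : nat) : nat -> nat -> bool :=
  if i is i'.+1 then impose (solved i') (ea i') (eb i') (ec i')
  else fun v j => v == j.

Variable x : nat -> bool.
Hypothesis one_in_three :
  forall i, i < m -> x (ea i) + x (eb i) + x (ec i) = 1.

Lemma parity_x i : i < m -> x (ea i) (+) x (eb i) (+) x (ec i).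
Proof. by move/one_in_three; case: (x _) (x _) (x _) => [] [] []. Qed.

(** The solution [x] is its own vector of parameters: true for the identity
    matrix at the start, and each edge only adds forms that vanish at [x]. *)
Lemma affine_solved i v :
  i <= m -> v < n -> affine (solved i v) x = x v.
Proof.
elim: i v => [|i IH] v im vn /=.
  rewrite /affine ltn_eqF //= (bigD1 (Ordinal vn)) //= eqxx big1 ?addbF //.
  by move=> j; rewrite -val_eqE /= eq_sym => /negbTE->.
have [an bn cn] := edges_lt im.
by rewrite affine_impose ?IH ?affine_residual ?IH ?parity_x // ltnW.
Qed.

Lemma residual_solved i k :
  k < i -> i <= m ->
  forall j, j <= n -> residual (solved i) (ea k) (eb k) (ec k) j = false.
Proof.
elim: i => // i IH; rewrite ltnS leq_eqVlt => /orP[/eqP->|ki] im.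
  have [an bn cn] := edges_lt im.
  apply: (@residual_impose _ _ _ _ x).
  by rewrite affine_residual !affine_solved ?parity_x // ltnW.
have {}IH := IH ki (ltnW im); rewrite /= /impose.
by case: ifP => // pn; apply: residual_eliminate.
Qed.

Notation A := (solved m).

Lemma affine_parity i y : i < m ->
  affine (A (ea i)) y (+) affine (A (eb i)) y (+) affine (A (ec i)) y.
Proof.
move=> im; have := affine_residual A (ea i) (eb i) (ec i) y.
rewrite (eq_affine (r2 := fun=> false)); last exact: residual_solved.
rewrite /affine big1 // => /esym/negbT.
by rewrite negbK.
Qed.

(** The last parameter in the form of [v], or [n] when the form is constant. *)
Definition pivot v := last_true (A v) n n.

Lemma pivot_forced v : v < n -> pivot v = n -> x v = A v n.
Proof.
rewrite /pivot => vn; case: last_trueP => [h _|p pn _ _ E]; last by lia.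
by rewrite -(affine_solved (leqnn m) vn) /affine big1 ?addbF // => j _; rewrite h.
Qed.

Lemma pivot_le v : pivot v <= n.
Proof. by rewrite /pivot; case: last_trueP => // *; apply: ltnW. Qed.

Lemma pivot_true v : pivot v < n -> A v (pivot v).
Proof. by rewrite /pivot; case: last_trueP => // *; lia. Qed.

Lemma pivot_after v j : pivot v < n -> pivot v < j -> j < n -> A v j = false.
Proof.
rewrite /pivot; case: last_trueP => [h|p pn rp h]; first by lia.
by move=> _ pj jn; apply: h.
Qed.

Section Greedy.

Variable act : nat -> bool.

(** Vertices that parameter [f] decides and that have value [b] as long as
    [f] is 0; setting [f] to 1 exchanges the two values. *)
Definition votes (X : nat -> bool) (f k : nat) (b : bool) : nat :=
  \sum_(v < k) [&& act v, pivot v == f & X v == b].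

Fixpoint greedy (f : nat) : nat -> bool :=
  if f is f'.+1 then
    let X := greedy f' in
    fun v => X v (+) (A v f' && (votes X f' n false < votes X f' n true))
  else fun v => A v n.

Lemma greedy_affine : exists y, forall v, greedy n v = affine (A v) y.
Proof.
exists (fun f => votes (greedy f) f n false < votes (greedy f) f n true) => v.
suff gE f : greedy f v = A v n (+) \big[addb/false]_(j < f)
    (A v j && (votes (greedy j) j n false < votes (greedy j) j n true)).
  exact: gE.
elim: f => [|f IH]; first by rewrite big_ord0 addbF.
by rewrite big_ord_recr /= IH addbA.
Qed.

Definition survivors (X : nat -> bool) (f : nat) : nat :=
  \sum_(v < n) [&& act v, pivot v < f & X v].

(** When parameter [f] is fixed, the vertices with an earlier pivot do not contain
    it and keep their value, while those with pivot [f] are split by it into two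
    parts, of which the smaller one gets 1. *)
Lemma greedy_half f : f <= n ->
  2 * survivors (greedy f) f <= \sum_(v < n) (act v && (pivot v < f)).
Proof.
elim: f => [|f IH] fn.
  by rewrite /survivors big1 ?muln0 // => v _; rewrite ltn0 andbF.
have {}IH := IH (ltnW fn).
set X := greedy f; set y := votes X f n false < votes X f n true.
have -> : \sum_(v < n) (act v && (pivot v < f.+1)) =
    \sum_(v < n) (act v && (pivot v < f)) + (votes X f n true + votes X f n false).
  rewrite /votes -!big_split; apply: eq_bigr => v _ /=.
  rewrite ltnS leq_eqVlt; case: (act v) => //=.
  by case: eqP => [->|_]; rewrite ?ltnn //=; case: (X v) => //=; case: (_ < _).
have -> : survivors (greedy f.+1) f.+1 = survivors X f + votes X f n (~~ y).
  rewrite /survivors /votes -big_split; apply: eq_bigr => v _ /=.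
  rewrite ltnS leq_eqVlt -/X -/y; case: (act v) => //=.
  case: eqP => [pf|_] /=.
    have /pivot_true : pivot v < n by rewrite pf.
    by rewrite pf ltnn => -> /=; case: (X v) y => [] [].
  case: ltnP => //= pf; rewrite pivot_after ?addbF ?addn0 //.
  exact: ltn_trans fn.
move: IH; rewrite -/X /y; case: ltnP => /= h; lia.
Qed.

End Greedy.

(** At [k = n] this is the number of active vertices with a non-constant form;
    at [k = v] it numbers such a vertex [v] among them. *)
Definition rank (act : nat -> bool) (k : nat) : nat :=
  \sum_(v < k) (act v && (pivot v < n)).

Definition step_act (act : nat -> bool) v := act v && greedy act n v.
(** Active vertices have colour 0 until they retire, so adding [r] assigns it. *)
Definition step_col (act : nat -> bool) (r : nat) (col : nat -> nat) v :=
  col v + r * (act v && ~~ greedy act n v).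

Lemma rank_step act : 2 * rank (step_act act) n <= rank act n.
Proof.
apply: leq_trans (greedy_half act (leqnn n)); rewrite leq_mul2l /=.
by apply: leq_sum => v _; rewrite /step_act; case: (act v); case: (greedy _ _ _);
   rewrite ?andbT.
Qed.

Definition unique_max (a b c : nat) : bool :=
  [|| (a < c) && (b < c), (a < b) && (c < b) | (b < a) && (c < a)].

(** An active vertex will end with a colour at least [r], so [r] is the value to
    compare with the colours of the retired vertices. *)
Definition shown (act : nat -> bool) (col : nat -> nat) (r v : nat) :=
  if act v then r else col v.

(** An edge that is not wholly active already has its unique maximum.  This maximum
    can be an active vertex, whose later increase does not matter; it cannot be
    shared by two active vertices, since both are shown with the same value. *)
Definition settled (act : nat -> bool) (col : nat -> nat) (r : nat) : Prop :=
  [/\ forall v, act v -> col v = 0,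
      forall v, v < n -> ~~ act v -> col v < r &
      forall i, i < m -> [&& act (ea i), act (eb i) & act (ec i)] ||
        unique_max (shown act col r (ea i)) (shown act col r (eb i))
                   (shown act col r (ec i))].

Lemma settled_start : settled xpredT (fun=> 0) 0.
Proof. by split. Qed.

Lemma settled_step act col r :
  settled act col r -> settled (step_act act) (step_col act r col) r.+1.
Proof.
case=> s1 s2 s3; split=> [v|v vn|i im].
- rewrite /step_act /step_col => /andP[av gv].
  by rewrite av gv s1 ?muln0.
- rewrite /step_act /step_col; have := s2 v vn; have := s1 v.
  by case: (act v) (greedy _ _ _) => [] [] //=; lia.
have [y gy] := greedy_affine act.
have := affine_parity y im; rewrite -!gy.
have [an bn cn] := edges_lt im.
have := s3 i im; rewrite /step_act /step_col /shown /unique_max.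
have := s1 (ea i); have := s1 (eb i); have := s1 (ec i).
have := s2 _ an; have := s2 _ bn; have := s2 _ cn.
case: (act (ea i)) (act (eb i)) (act (ec i)) => [] [] [] /=;
case: (greedy act n (ea i)) (greedy act n (eb i)) (greedy act n (ec i)) => [] [] [] //=; lia.
Qed.

(** [bits] lists the guessed values of the active vertices with a non-constant
    form, in increasing order of the vertices. *)
Definition final_col (act : nat -> bool) (col : nat -> nat) (r : nat)
    (bits : nat -> bool) (v : nat) : nat :=
  if act v then r + (if pivot v < n then bits (rank act v) else A v n)
  else col v.

Lemma rank_le (act : nat -> bool) k1 k2 : k1 <= k2 -> rank act k1 <= rank act k2.
Proof.
move=> /subnKC <-; elim: (k2 - k1) => [|d IH]; first by rewrite addn0.
by rewrite addnS /rank big_ord_recr /=; apply: leq_trans IH (leq_addr _ _).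
Qed.

Lemma rank_lt (act : nat -> bool) u v : u < v -> act u -> pivot u < n -> rank act u < rank act v.
Proof.
move=> uv au pu; apply: leq_trans (rank_le act uv).
by rewrite /rank big_ord_recr /= au pu addn1.
Qed.

(** The guess that reads its bits off the hidden colouring [x] succeeds: a
    wholly active edge receives [r] twice and [r + 1] once. *)
Lemma winning_bits (act : nat -> bool) col r : settled act col r ->
  exists bits, forall i, i < m ->
    unique_max (final_col act col r bits (ea i)) (final_col act col r bits (eb i))
               (final_col act col r bits (ec i)).
Proof.
case=> s1 s2 s3.
pose bits k := has (fun v => [&& act v, pivot v < n, rank act v == k & x v]) (iota 0 n).
have bitsE v : v < n -> act v -> pivot v < n -> bits (rank act v) = x v.
  move=> vn av pv; apply/hasP/idP => [[u _ /and4P[au pu /eqP ruv xu]]|xv].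
    case: (ltngtP u v) => [uv|vu|<- //].
      by have := rank_lt uv au pu; lia.
    by have := rank_lt vu av pv; lia.
  by exists v; rewrite ?mem_iota // av pv eqxx.
have finE v : v < n -> final_col act col r bits v = if act v then r + x v else col v.
  move=> vn; rewrite /final_col; case: ifP => // av; case: ifP => pv.
    by rewrite bitsE.
  by rewrite pivot_forced //; have := pivot_le v; lia.
exists bits => i im; have [an bn cn] := edges_lt im; rewrite !finE //.
have := one_in_three im; have := s3 i im; rewrite /shown /unique_max.
have := s2 _ an; have := s2 _ bn; have := s2 _ cn.
case: (act (ea i)) (act (eb i)) (act (ec i)) => [] [] [] /=;
case: (x (ea i)) (x (eb i)) (x (ec i)) => [] [] [] //=; lia.
Qed.

Lemma final_col_lt act col r bits v : v < n ->
  settled act col r -> final_col act col r bits v < r.+2.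
Proof.
move=> vn [_ s2 _]; rewrite /final_col; have := s2 v vn.
case: (act v) => /= [_|/(_ isT)]; last by lia.
by case: (if _ then _ else _) => /=; lia.
Qed.

End Elimination.

(** * The program *)

(** Registers.  0: [n]; 1: [m]; 2: start of the table; 3: length of its rows;
    4: current edge; 5, 6, 7: its vertices, then their colours; 8: a vertex;
    9: a column; 10: pivot of the residual; 11: a factor; 12: the parameter being
    fixed; 13, 14: votes for 0 and 1; 15: number of active vertices with a
    non-constant form; 16: current round; 17: verdict on a guess; 18: rank.

    Table.  Row [v < n] belongs to vertex [v]: its form in columns 0 to [n], then
    in columns [n + 1] to [n + 4] its pivot, its value in the chosen solution,
    whether it is active, and its colour.  Row [n] holds a residual and row [n + 1]
    the guessed bits. *)

Definition for_ (x : nat) (e : expr) (p : cmd) : cmd :=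
  Seq (SetReg x (Const 0))
      (While (Bin OpLt (Reg x) e)
             (Seq p (SetReg x (Bin OpAdd (Reg x) (Const 1))))).

Definition cell_expr (i j : expr) : expr :=
  Bin OpAdd (Reg 2) (Bin OpAdd (Bin OpMul i (Reg 3)) j).
Definition get (i j : expr) : expr := Fetch (cell_expr i j).
Definition put (i j e : expr) : cmd := Store (cell_expr i j) e.

Definition field (k : nat) : expr := Bin OpAdd (Reg 0) (Const k).

Definition xor (e1 e2 : expr) : expr := Bin OpEq (Bin OpEq e1 e2) (Const 0).

(** A choice by the bit [c] without branching, which keeps loop bodies
    straight-line. *)
Definition sel (c e1 e2 : expr) : expr :=
  Bin OpAdd (Bin OpMul c e1) (Bin OpMul (Bin OpEq c (Const 0)) e2).
Definition vertex (k : nat) : expr :=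
  Fetch (Bin OpAdd (Bin OpMul (Const 3) (Reg 4)) (Const (k + 2))).

Definition load_edge : cmd :=
  Seq (SetReg 5 (vertex 0)) (Seq (SetReg 6 (vertex 1)) (SetReg 7 (vertex 2))).

(** On bits, two nested equality tests give the sum modulo 2 of three values; the
    constant column is negated because of the right-hand side 1. *)
Definition load_residual : cmd :=
  Seq (SetReg 10 (Reg 0))
  (Seq (for_ 9 (Reg 0)
         (Seq (put (Reg 0) (Reg 9)
                (Bin OpEq (Bin OpEq (get (Reg 5) (Reg 9)) (get (Reg 6) (Reg 9)))
                          (get (Reg 7) (Reg 9))))
              (SetReg 10 (sel (get (Reg 0) (Reg 9)) (Reg 9) (Reg 10)))))
       (put (Reg 0) (Reg 0)
         (xor (Bin OpEq (get (Reg 5) (Reg 0)) (get (Reg 6) (Reg 0)))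
              (get (Reg 7) (Reg 0))))).

(** The factor is saved in register 11 because the inner loop overwrites the
    cell that it is read from. *)
Definition eliminate_cmd : cmd :=
  for_ 8 (Reg 0)
    (Seq (SetReg 11 (get (Reg 8) (Reg 10)))
         (for_ 9 (field 1)
           (put (Reg 8) (Reg 9)
             (xor (get (Reg 8) (Reg 9))
                  (Bin OpMul (Reg 11) (get (Reg 0) (Reg 9))))))).

Definition impose_cmd : cmd :=
  Seq load_edge
  (Seq load_residual
       (If (Bin OpLt (Reg 10) (Reg 0)) eliminate_cmd Skip)).

Definition solve_cmd : cmd :=
  Seq (for_ 8 (Reg 0) (put (Reg 8) (Reg 8) (Const 1)))
      (for_ 4 (Reg 1) impose_cmd).

Definition analyse_cmd : cmd :=
  Seq (SetReg 15 (Const 0))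
  (for_ 8 (Reg 0)
    (Seq (put (Reg 8) (field 1) (Reg 0))
    (Seq (for_ 9 (Reg 0)
           (put (Reg 8) (field 1)
             (sel (get (Reg 8) (Reg 9)) (Reg 9) (get (Reg 8) (field 1)))))
    (Seq (put (Reg 8) (field 3) (Const 1))
         (SetReg 15 (Bin OpAdd (Reg 15)
                      (Bin OpLt (get (Reg 8) (field 1)) (Reg 0)))))))).

Definition count_votes : cmd :=
  Seq (SetReg 13 (Const 0))
  (Seq (SetReg 14 (Const 0))
  (for_ 8 (Reg 0)
    (Seq (SetReg 11 (Bin OpMul (get (Reg 8) (field 3))
                               (Bin OpEq (get (Reg 8) (field 1)) (Reg 12))))
    (Seq (SetReg 13 (Bin OpAdd (Reg 13)
            (Bin OpMul (Reg 11) (Bin OpEq (get (Reg 8) (field 2)) (Const 0)))))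
         (SetReg 14 (Bin OpAdd (Reg 14)
            (Bin OpMul (Reg 11) (get (Reg 8) (field 2))))))))).

Definition flip_cmd : cmd :=
  for_ 8 (Reg 0)
    (put (Reg 8) (field 2) (xor (get (Reg 8) (field 2)) (get (Reg 8) (Reg 12)))).

Definition greedy_cmd : cmd :=
  Seq (for_ 8 (Reg 0) (put (Reg 8) (field 2) (get (Reg 8) (Reg 0))))
      (for_ 12 (Reg 0)
        (Seq count_votes (If (Bin OpLt (Reg 13) (Reg 14)) flip_cmd Skip))).

Definition retire_cmd : cmd :=
  Seq (SetReg 15 (Const 0))
  (for_ 8 (Reg 0)
    (Seq (put (Reg 8) (field 4)
           (Bin OpAdd (get (Reg 8) (field 4))
             (Bin OpMul (Bin OpMul (get (Reg 8) (field 3))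
                                   (Bin OpEq (get (Reg 8) (field 2)) (Const 0)))
                        (Reg 16))))
    (Seq (put (Reg 8) (field 3)
           (Bin OpMul (get (Reg 8) (field 3)) (get (Reg 8) (field 2))))
         (SetReg 15 (Bin OpAdd (Reg 15)
           (Bin OpMul (get (Reg 8) (field 3))
                      (Bin OpLt (get (Reg 8) (field 1)) (Reg 0)))))))).

Definition round_cmd : cmd :=
  Seq greedy_cmd (Seq retire_cmd (SetReg 16 (Bin OpAdd (Reg 16) (Const 1)))).

Definition rounds_cmd : cmd :=
  Seq (SetReg 16 (Const 0)) (While (Bin OpLt (Const 7) (Reg 15)) round_cmd).

Definition paint_cmd : cmd :=
  Seq (SetReg 18 (Const 0))
  (for_ 8 (Reg 0)
    (Seq (put (Reg 8) (field 4)
           (sel (get (Reg 8) (field 3))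
             (Bin OpAdd (Reg 16)
               (sel (Bin OpLt (get (Reg 8) (field 1)) (Reg 0))
                    (get (field 1) (Reg 18)) (get (Reg 8) (Reg 0))))
             (get (Reg 8) (field 4))))
         (SetReg 18 (Bin OpAdd (Reg 18)
           (Bin OpMul (get (Reg 8) (field 3))
                      (Bin OpLt (get (Reg 8) (field 1)) (Reg 0))))))).

Definition dominates (a b c : nat) : expr :=
  Bin OpMul (Bin OpLt (Reg a) (Reg c)) (Bin OpLt (Reg b) (Reg c)).

Definition check_cmd : cmd :=
  Seq (SetReg 17 (Const 1))
  (for_ 4 (Reg 1)
    (Seq load_edge
    (Seq (SetReg 5 (get (Reg 5) (field 4)))
    (Seq (SetReg 6 (get (Reg 6) (field 4)))
    (Seq (SetReg 7 (get (Reg 7) (field 4)))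
         (SetReg 17 (Bin OpMul (Reg 17)
           (Bin OpAdd (dominates 5 6 7)
             (Bin OpAdd (dominates 5 7 6) (dominates 6 7 5)))))))))).

Definition set_bit (k b : nat) : cmd := put (field 1) (Const k) (Const b).

(** A tree of depth [k] over the bits below [k], unrolled into the program text;
    it stops at the first guess that passes the check. *)
Fixpoint search_cmd (k : nat) : cmd :=
  if k is k'.+1 then
    Seq (set_bit k' 0)
    (Seq (search_cmd k')
         (If (Reg 17) Skip (Seq (set_bit k' 1) (search_cmd k'))))
  else Seq paint_cmd check_cmd.

Definition output_cmd : cmd :=
  for_ 8 (Reg 0) (Store (Reg 8) (get (Reg 8) (field 4))).

Definition colouring_cmd : cmd :=
  Seq solve_cmd (Seq analyse_cmd (Seq rounds_cmd (Seq (search_cmd 8) output_cmd))).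

Definition setup_cmd : cmd :=
  Seq (SetReg 0 (Fetch (Const 0)))
  (Seq (SetReg 1 (Fetch (Const 1)))
  (Seq (SetReg 2 (Bin OpAdd (Reg 0)
         (Bin OpAdd (Bin OpMul (Const 3) (Reg 1)) (Const 2))))
       (SetReg 3 (Bin OpAdd (Reg 0) (Const 8))))).

Definition log_colouring_cmd : cmd := Seq setup_cmd colouring_cmd.

(** * A calculus for time and memory *)

Fixpoint writes (p : cmd) : seq nat :=
  match p with
  | Skip | Store _ _ => [::]
  | SetReg r _ => [:: r]
  | Seq p q | If _ p q => writes p ++ writes q
  | While _ p => writes p
  end.

Definition regs := nat -> nat.
Definition table := nat -> nat -> nat.

Definition upd2 (M : table) (i j x : nat) : table :=
  fun a b => if (a == i) && (b == j) then x else M a b.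

Section Logic.

Variables (n m w : nat).

(** Rows have room for a form, the four fields of a vertex, and at least eight
    bits.  The table lies beyond the input and beyond the cells of the output.
    Row [low] of the table is a name for the cells below it. *)
Definition stride := n + 8.
Definition base := n + (3 * m + 2).
Definition low := n.+2.
Definition addr (i j : nat) : nat := if i == low then j else base + (i * stride + j).
Definition valid (i j : nat) : bool := if i == low then j < base else (i < low) && (j < stride).

Hypothesis w_large : base + low * stride + 100 <= 2 ^ w.

Lemma addr_inj i j i' j' :
  valid i j -> valid i' j' -> addr i j = addr i' j' -> i = i' /\ j = j'.
Proof.
rewrite /valid /addr; case: eqP => [->|_]; case: eqP => [->|_] //; try by lia.
move=> /andP[_ jq] /andP[_ jq'] /addnI E.
have: (i * stride + j) %/ stride = (i' * stride + j') %/ stride by rewrite E.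
have q0 : 0 < stride by rewrite /stride addn_gt0 orbT.
rewrite !divnMDl // (divn_small jq) (divn_small jq') !addn0 => ii.
by split=> //; move: E; rewrite ii => /addnI.
Qed.

Lemma addr_lt i j : valid i j -> addr i j < 2 ^ w.
Proof.
move: w_large; rewrite /valid /addr; case: eqP => _; first by lia.
move=> h /andP[il jq]; have : i.+1 * stride <= low * stride by rewrite leq_mul2r il orbT.
by rewrite mulSn; lia.
Qed.

(** The bounds on registers and memory hold in all states that the program
    reaches, as every computed value is reduced to a word; they make a product
    with a bit, or a choice between two values, free of overflow. *)
Record represents (rho : regs) (M : table) (s : state) : Prop := Represents {
  rep_reg : reg s = rho;
  rep_reg_lt : forall r, rho r < 2 ^ w;
  rep_ram_lt : forall a, ram s a < 2 ^ w;
  rep_n : rho 0 = n;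
  rep_m : rho 1 = m;
  rep_base : rho 2 = base;
  rep_stride : rho 3 = stride;
  rep_table : forall i j, valid i j -> ram s (addr i j) = M i j }.

Definition ev (rho : regs) (M : table) (e : expr) (x : nat) : Prop :=
  forall s, represents rho M s -> eval w s e = x.

Lemma word_small x : x < 2 ^ w -> word w x = x.
Proof. exact: modn_small. Qed.

Lemma eval_lt rho M s e : represents rho M s -> eval w s e < 2 ^ w.
Proof.
move=> R; case: e => [x|r|e|o e1 e2] /=; first by rewrite ltn_mod expn_gt0.
- by rewrite (rep_reg R) (rep_reg_lt R).
- exact: rep_ram_lt R _.
- by case: o => /=; rewrite ltn_mod expn_gt0.
Qed.

Section Evaluation.

Variables (rho : regs) (M : table).

Notation ev := (ev rho M).

Lemma ev_const x : x < 100 -> ev (Const x) x.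
Proof. by move=> xl s R /=; rewrite word_small //; move: w_large; lia. Qed.

Lemma ev_reg r : ev (Reg r) (rho r).
Proof. by move=> s /rep_reg <-. Qed.

Lemma ev_n : ev (Reg 0) n.
Proof. by move=> s R /=; rewrite (rep_reg R) (rep_n R). Qed.

Lemma ev_m : ev (Reg 1) m.
Proof. by move=> s R /=; rewrite (rep_reg R) (rep_m R). Qed.

Lemma ev_add e1 e2 x y :
  ev e1 x -> ev e2 y -> x + y < 2 ^ w -> ev (Bin OpAdd e1 e2) (x + y).
Proof. by move=> h1 h2 l s R /=; rewrite (h1 s R) (h2 s R) word_small. Qed.

Lemma ev_mul e1 e2 x y :
  ev e1 x -> ev e2 y -> x <= 1 -> ev (Bin OpMul e1 e2) (x * y).
Proof.
move=> h1 h2 l s R /=; have yl := eval_lt e2 R.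
rewrite (h2 s R) in yl *; rewrite (h1 s R) word_small //.
case: x l {h1} => [|[|]]; lia.
Qed.

Lemma ev_mul3 e x : ev e x -> 3 * x < 2 ^ w -> ev (Bin OpMul (Const 3) e) (3 * x).
Proof.
by move=> h l s R; have := ev_const (isT : 3 < 100) R => /= ->; rewrite (h s R) word_small.
Qed.

Lemma ev_eqb e1 e2 x y : ev e1 x -> ev e2 y -> ev (Bin OpEq e1 e2) (x == y).
Proof.
move=> h1 h2 s R /=; rewrite (h1 s R) (h2 s R) word_small //.
by move: w_large; case: (x == y); lia.
Qed.

Lemma ev_ltb e1 e2 x y : ev e1 x -> ev e2 y -> ev (Bin OpLt e1 e2) (x < y).
Proof.
move=> h1 h2 s R /=; rewrite (h1 s R) (h2 s R) word_small //.
by move: w_large; case: (x < y); lia.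
Qed.

Definition ev_addr e i j := ev e (addr i j).

Lemma ev_cell e1 e2 i j :
  ev e1 i -> ev e2 j -> i < low -> j < stride -> ev_addr (cell_expr e1 e2) i j.
Proof.
move=> h1 h2 il jq s R /=.
rewrite (h1 s R) (h2 s R) (rep_reg R) (rep_base R) (rep_stride R).
have v : valid i j by rewrite /valid ltn_eqF // il.
have := addr_lt v; rewrite /addr ltn_eqF // => l.
by rewrite !word_small //; lia.
Qed.

Lemma ev_low e a : ev e a -> ev_addr e low a.
Proof. by rewrite /ev_addr /addr eqxx. Qed.

Lemma ev_fetch e i j : ev_addr e i j -> valid i j -> ev (Fetch e) (M i j).
Proof. by move=> h v s R /=; rewrite (h s R) (rep_table R). Qed.

Lemma ev_get e1 e2 i j :
  ev e1 i -> ev e2 j -> i < low -> j < stride -> ev (get e1 e2) (M i j).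
Proof.
move=> h1 h2 il jq; apply: ev_fetch; first exact: ev_cell.
by rewrite /valid ltn_eqF // il.
Qed.

End Evaluation.

Definition post := nat -> regs -> table -> Prop.

(** [Q] receives the time at the end when [t] is the time at the start.  The frame
    condition on registers is part of the definition, so that loop invariants need
    only speak of the registers that the loop changes. *)
Definition wp (p : cmd) (Q : post) (t : nat) (rho : regs) (M : table) : Prop :=
  forall s, represents rho M s ->
  exists t' s' rho' M',
    [/\ exec w p s t' s', represents rho' M' s',
        forall r, r \notin writes p -> rho' r = rho r & Q (t + t') rho' M'].

Lemma wp_conseq p (Q1 Q : post) t rho M :
  wp p Q1 t rho M ->
  (forall t' rho' M', (forall r, r \notin writes p -> rho' r = rho r) ->
     Q1 t' rho' M' -> Q t' rho' M') ->
  wp p Q t rho M.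
Proof.
move=> h c s /h[t' [s' [rho' [M' [E R F q]]]]].
by exists t', s', rho', M'; split=> //; apply: c.
Qed.

Lemma wp_skip (Q : post) t rho M : Q (t + 1) rho M -> wp Skip Q t rho M.
Proof. by move=> q s R; exists 1, s, rho, M; split=> //; constructor. Qed.

Lemma wp_set r e x (Q : post) t rho M :
  ev rho M e x -> 3 < r -> Q (t + (cost e).+1) (upd rho r x) M ->
  wp (SetReg r e) Q t rho M.
Proof.
move=> h r3 q s R; have xl := eval_lt e R; rewrite (h s R) in xl.
exists (cost e).+1, (State (upd (reg s) r (eval w s e)) (ram s)), (upd rho r x), M.
split=> //; first by constructor.
- rewrite (h s R); split=> /=; rewrite ?(rep_reg R) //; last exact: rep_table R.
  + by move=> r'; rewrite /upd; case: ifP => // _; apply: rep_reg_lt R _.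
  + exact: rep_ram_lt R.
  + by rewrite /upd ltn_eqF ?(rep_n R) // (leq_trans _ r3).
  + by rewrite /upd ltn_eqF ?(rep_m R) // (leq_trans _ r3).
  + by rewrite /upd ltn_eqF ?(rep_base R) // (leq_trans _ r3).
  + by rewrite /upd ltn_eqF ?(rep_stride R) // (leq_trans _ r3).
- by move=> r'; rewrite inE /upd => /negbTE->.
Qed.

Lemma wp_store a e i j x (Q : post) t rho M :
  ev_addr rho M a i j -> valid i j -> ev rho M e x ->
  Q (t + (cost a + cost e).+1) rho (upd2 M i j x) ->
  wp (Store a e) Q t rho M.
Proof.
move=> ha v he q s R; have xl := eval_lt e R; rewrite (he s R) in xl.
exists (cost a + cost e).+1,
  (State (reg s) (upd (ram s) (eval w s a) (eval w s e))), rho, (upd2 M i j x).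
split=> //; first by constructor.
rewrite (ha s R) (he s R); case: R => *; split=> //= [b|i' j' v'].
  by rewrite /upd; case: ifP.
rewrite /upd /upd2; case: eqP => [/addr_inj [] // -> ->|ne]; first by rewrite !eqxx.
case: ifP => [/andP[/eqP ii /eqP jj]|_]; first by case: ne; rewrite ii jj.
by auto.
Qed.

Lemma wp_put e1 e2 e i j x (Q : post) t rho M :
  ev rho M e1 i -> ev rho M e2 j -> ev rho M e x -> i < low -> j < stride ->
  Q (t + (cost e1 + cost e2 + 5 + cost e).+1) rho (upd2 M i j x) ->
  wp (put e1 e2 e) Q t rho M.
Proof.
move=> h1 h2 h il jq q.
apply: (wp_store (ev_cell h1 h2 il jq)); [by rewrite /valid ltn_eqF // il|exact: h|].
by rewrite /=; move: q; congr (Q (_ + _) _ _); lia.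
Qed.

Lemma wp_seq p q (Q : post) t rho M :
  wp p (fun t1 rho1 M1 =>
    (forall r, r \notin writes p -> rho1 r = rho r) -> wp q Q t1 rho1 M1) t rho M ->
  wp (Seq p q) Q t rho M.
Proof.
move=> h s /h[t1 [s1 [rho1 [M1 [E1 R1 F1 h1]]]]].
have [t2 [s2 [rho2 [M2 [E2 R2 F2 q2]]]]] := h1 F1 _ R1.
exists (t1 + t2), s2, rho2, M2; split=> //; last by rewrite addnA.
  exact: ExecSeq E1 E2.
by move=> r /=; rewrite mem_cat => /norP[/F1<- /F2].
Qed.

Lemma wp_if e (b : bool) p q (Q : post) t rho M :
  ev rho M e b ->
  (b -> wp p Q (t + (cost e).+1) rho M) ->
  (~~ b -> wp q Q (t + (cost e).+1) rho M) ->
  wp (If e p q) Q t rho M.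
Proof.
move=> h hp hq s R; have es := h s R; case: b h es hp hq => h es hp hq.
  have [t1 [s1 [rho1 [M1 [E1 R1 F1 q1]]]]] := hp isT _ R.
  exists (cost e + t1).+1, s1, rho1, M1; split=> //.
  - by apply: ExecIfTrue E1; rewrite es.
  - by move=> r /=; rewrite mem_cat => /norP[/F1].
  - by move: q1; congr (Q _ _ _); lia.
have [t1 [s1 [rho1 [M1 [E1 R1 F1 q1]]]]] := hq isT _ R.
exists (cost e + t1).+1, s1, rho1, M1; split=> //.
- by apply: ExecIfFalse E1; rewrite es.
- by move=> r /=; rewrite mem_cat => /norP[_ /F1].
- by move: q1; congr (Q _ _ _); lia.
Qed.

(** [J k] is an invariant under which at most [k] iterations remain. *)
Lemma wp_while (J : nat -> post) (N : nat) e p (Q : post) t rho M :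
  J N t rho M ->
  (forall k t' rho' M', (forall r, r \notin writes p -> rho' r = rho r) ->
     J k t' rho' M' -> exists2 b : bool, ev rho' M' e b &
       if b then 0 < k /\ wp p (J k.-1) (t' + (cost e).+1) rho' M'
       else Q (t' + (cost e).+1) rho' M') ->
  wp (While e p) Q t rho M.
Proof.
move=> j0 step.
have main k t1 rho1 M1 : (forall r, r \notin writes p -> rho1 r = rho r) ->
    J k t1 rho1 M1 -> wp (While e p) Q t1 rho1 M1; last exact: main j0.
elim: k t1 rho1 M1 => [|k IH] t1 rho1 M1 F1 J1 s R;
  have [[] eb] := step _ _ _ _ F1 J1; rewrite -?pred_Sn.
- by case.
- move=> q; exists (cost e).+1, s, rho1, M1; split=> //.
  by apply: ExecWhileDone; rewrite (eb s R).
- case=> _ h; have [t2 [s2 [rho2 [M2 [E2 R2 F2 J2]]]]] := h _ R.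
  have F12 r : r \notin writes p -> rho2 r = rho r by move=> hr; rewrite F2 ?F1.
  have [t3 [s3 [rho3 [M3 [E3 R3 F3 Q3]]]]] := IH _ _ _ F12 J2 _ R2.
  exists (cost e + t2 + t3).+1, s3, rho3, M3; split=> //.
  + by apply: ExecWhileStep E2 E3; rewrite (eb s R).
  + by move=> r hr; rewrite F3 ?F2.
  + by move: Q3; congr (Q _ _ _); lia.
- move=> q; exists (cost e).+1, s, rho1, M1; split=> //.
  by apply: ExecWhileDone; rewrite (eb s R).
Qed.

(** The invariant is stated after the update of the loop counter, and it carries
    the time, so that iterations of unequal cost can be amortised. *)
Lemma wp_for x e p N (J : nat -> post) (Q : post) t rho M :
  3 < x -> x \notin writes p -> (forall rho M, ev rho M e N) ->
  J 0 (t + 2) (upd rho x 0) M ->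
  (forall i t' rho' M', i < N -> rho' x = i ->
     (forall r, r \notin x :: writes p -> rho' r = rho r) -> J i t' rho' M' ->
     wp p (fun t1 rho1 M1 => J i.+1 (t1 + 4) (upd rho1 x i.+1) M1)
        (t' + (cost e + 3)) rho' M') ->
  (forall t' rho' M', J N t' rho' M' -> Q (t' + (cost e + 3)) rho' M') ->
  wp (for_ x e p) Q t rho M.
Proof.
move=> x3 xp hN j0 body fin; apply: wp_seq.
apply: (wp_set (x := 0)) => //; first exact: ev_const.
move=> _; apply: (@wp_while
  (fun k t rho M => exists i, [/\ i + k = N, rho x = i & J i t rho M]) N).
  by exists 0; split=> //; rewrite /upd eqxx.
move=> k t' rho' M' F' [i [ikN xi Ji]]; exists (i < N).
  by apply: ev_ltb; [rewrite -xi; apply: ev_reg|apply: hN].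
rewrite /= add1n; case: ltnP => iN; last first.
  by rewrite -addn3; apply: fin; rewrite (_ : N = i) //; lia.
split; first by lia.
apply: wp_seq; rewrite -addn3; apply: wp_conseq.
  apply: body Ji => // r hr; rewrite F'; last first.
    by rewrite /= mem_cat inE orbC -in_cons.
  by move: hr; rewrite /upd inE => /norP[/negbTE->].
move=> t1 rho1 M1 F1 J1 _; apply: (wp_set (x := i.+1)) => //.
  move=> s R; have NW := eval_lt e R; rewrite (hN _ _ _ R) in NW.
  rewrite -(addn1 i); apply: ev_add R; [|exact: ev_const|by lia].
  by rewrite -xi -F1 //; apply: ev_reg.
exists i.+1; split=> //; first by lia.
by rewrite /upd eqxx.
Qed.

End Logic.

(** * Elimination *)

Section Specs.

Variables n m w : nat.
Hypothesis w_large : base n m + low n * stride n + 100 <= 2 ^ w.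

Notation ev := (ev n m w).
Notation wp := (wp n m w).

Implicit Types (rho : regs) (M : table) (Q : post) (A : nat -> nat -> bool).

Lemma wp_for_const x e p N K (J : nat -> regs -> table -> Prop) t rho M :
  3 < x -> x \notin writes p -> (forall rho M, ev rho M e N) ->
  J 0 (upd rho x 0) M ->
  (forall i t' rho' M', i < N -> rho' x = i ->
     (forall r, r \notin x :: writes p -> rho' r = rho r) -> J i rho' M' ->
     wp p (fun t1 rho1 M1 => t1 <= t' + K /\ J i.+1 (upd rho1 x i.+1) M1)
        t' rho' M') ->
  wp (for_ x e p)
    (fun t1 rho1 M1 => t1 <= t + N * (K + cost e + 7) + (cost e + 5) /\ J N rho1 M1)
    t rho M.
Proof.
move=> x3 xp hN j0 body.
apply: (wp_for w_large (N := N) (J := fun i t' rho' M' =>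
   t' <= t + 2 + i * (K + cost e + 7) /\ J i rho' M')) => //.
- by rewrite mul0n addn0.
- move=> i t' rho' M' iN xi F [t'le Ji].
  apply: wp_conseq; first exact: (body _ (t' + (cost e + 3)) _ _ iN xi F Ji).
  by move=> t1 rho1 M1 _ [t1le J1]; split=> //; rewrite mulSn; lia.
- by move=> t' rho' M' [t'le JN]; split=> //; lia.
Qed.

Lemma ev_field rho M k : k < 100 -> ev rho M (field k) (n + k).
Proof.
move=> k100; apply: ev_add; [exact: ev_n|exact: ev_const|].
by move: w_large; rewrite /base; lia.
Qed.

Lemma ev_reg_eq rho M r x : rho r = x -> ev rho M (Reg r) x.
Proof. by move<-; apply: ev_reg. Qed.

Lemma ev_sel rho M c e1 e2 x y1 y2 :
  ev rho M c x -> x <= 1 -> ev rho M e1 y1 -> ev rho M e2 y2 ->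
  ev rho M (sel c e1 e2) (if x == 0 then y2 else y1).
Proof.
move=> hc x1 h1 h2 s R; have := eval_lt e1 R; have := eval_lt e2 R.
rewrite (h1 s R) (h2 s R) => l2 l1.
have -> : (if x == 0 then y2 else y1) = x * y1 + (x == 0) * y2.
  by case: x x1 {hc} => [|[|]] //= _; lia.
apply: (ev_add _ _ _ R); [by apply: ev_mul|apply: ev_mul => //|].
- by apply: ev_eqb => //; apply: ev_const.
- by case: eqP.
- by case: x x1 {hc} => [|[|]] //= _; lia.
Qed.

End Specs.

Ltac side W := first
  [ by [] | eassumption | generalize W; rewrite /low /stride /base; lia | idtac ].

(** Symbolic evaluation by structure of the expression: the value is read off
    as an open term, and the bounds are left to arithmetic. *)
Ltac evalue W :=
  lazymatch goal with
  | |- ev _ _ _ _ _ (Const _) _ => eapply (ev_const W); side W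
  | |- ev _ _ _ _ _ (field _) _ => eapply (ev_field W); side W
  | |- ev _ _ _ _ _ (Reg 0) _ => apply: ev_n
  | |- ev _ _ _ _ _ (Reg 1) _ => apply: ev_m
  | |- ev _ _ _ _ _ (Reg _) _ =>
      first [ eapply ev_reg_eq; eassumption
            | eapply ev_reg_eq; rewrite /upd /=; (eassumption || reflexivity) ]
  | |- ev _ _ _ _ _ (get _ _) _ => eapply (ev_get W); [evalue W|evalue W|side W|side W]
  | |- ev _ _ _ _ _ (xor _ _) _ =>
      eapply (ev_eqb W); [evalue W|evalue W]
  | |- ev _ _ _ _ _ (sel _ _ _) _ => eapply (ev_sel W); [evalue W|side W|evalue W|evalue W]
  | |- ev _ _ _ _ _ (Bin OpEq _ _) _ => eapply (ev_eqb W); [evalue W|evalue W]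
  | |- ev _ _ _ _ _ (Bin OpLt _ _) _ => eapply (ev_ltb W); [evalue W|evalue W]
  | |- ev _ _ _ _ _ (Bin OpMul (Const 3) _) _ => eapply (ev_mul3 W); [evalue W|side W]
  | |- ev _ _ _ _ _ (Bin OpMul _ _) _ => eapply (ev_mul W); [evalue W|evalue W|side W]
  | |- ev _ _ _ _ _ (Bin OpAdd _ _) _ => eapply ev_add; [evalue W|evalue W|side W]
  end.

Section Elim.

Variables n m w : nat.
Hypothesis n_gt3 : 3 < n.
Hypothesis w_large : base n m + low n * stride n + 100 <= 2 ^ w.

Notation ev := (ev n m w).
Notation wp := (wp n m w).

Implicit Types (rho : regs) (M : table) (Q : post) (A : nat -> nat -> bool).

Variables ea eb ec : nat -> nat.
Hypothesis edges_lt : forall i, i < m -> [/\ ea i < n, eb i < n & ec i < n].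

Definition stores_edges M : Prop := forall i, i < m ->
  [/\ M (low n) (3 * i + 2) = ea i, M (low n) (3 * i + 3) = eb i &
      M (low n) (3 * i + 4) = ec i].

Lemma wp_load_edge i Q t rho M :
  i < m -> rho 4 = i -> stores_edges M ->
  Q (t + 7 + 7 + 7) (upd (upd (upd rho 5 (ea i)) 6 (eb i)) 7 (ec i)) M ->
  wp load_edge Q t rho M.
Proof.
move=> im r4 inp q; have [ia ib ic] := inp i im.
have evx k x rho' : k < 3 -> rho' 4 = i -> M (low n) (3 * i + (k + 2)) = x ->
    ev rho' M (vertex k) x.
  move=> k3 r4' <-; apply: (@ev_fetch n m w) ; last by rewrite /valid eqxx /base; lia.
  by apply: ev_low; evalue w_large.
apply: wp_seq; apply: (wp_set (x := ea i)) => // [|_].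
  exact: evx.
apply: wp_seq; apply: (wp_set (x := eb i)) => // [|_].
  exact: evx.
apply: (wp_set (x := ec i)) => //.
exact: evx.
Qed.

Definition encodes M A : Prop := forall v j, v < n -> j <= n -> M v j = A v j.

Lemma wp_load_residual A a b c t rho M (r := residual n A a b c) :
  a < n -> b < n -> c < n -> rho 5 = a -> rho 6 = b -> rho 7 = c -> encodes M A ->
  wp load_residual
    (fun t1 rho1 M1 => [/\ t1 <= t + 200 * n, rho1 10 = last_true r n n &
       forall u j, M1 u j = if (u == n) && (j <= n) then nat_of_bool (r j) else M u j]) t rho M.
Proof.
move=> an bn cn r5 r6 r7 enc.
apply: wp_seq; apply: (wp_set (x := n)) => // [|_].
  by evalue w_large.
apply: wp_seq; apply: wp_conseq.
  apply: (wp_for_const w_large (N := n) (K := 100) (J := fun i rho1 M1 =>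
    rho1 10 = last_true r n i /\
    forall u j, M1 u j = if (u == n) && (j < i) then nat_of_bool (r j) else M u j)) => //.
  - exact: ev_n.
  - by split=> // u j; rewrite ltn0 andbF.
  move=> i t1 rho1 M1 iN r9 F [r10 E].
  have r51 : rho1 5 = a by rewrite F.
  have r61 : rho1 6 = b by rewrite F.
  have r71 : rho1 7 = c by rewrite F.
  apply: wp_seq; eapply (wp_put w_large);
    [by evalue w_large..|by rewrite /low|by rewrite /stride; lia|].
  set z := (X in upd2 _ _ _ X).
  have zr : z = r i.
    rewrite /z !E (ltn_eqF an) (ltn_eqF bn) (ltn_eqF cn) /= !enc ?(ltnW iN) //.
    rewrite /r /residual (ltn_eqF iN).
    by case: (A a i) (A b i) (A c i) => [] [] [].
  move=> _; eapply wp_set; [|by []|].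
    evalue w_large; rewrite /upd2 !eqxx zr; exact: leq_b1.
  rewrite /upd2 !eqxx /= zr; split; first by lia.
  split; first by rewrite /upd /=; case: (r i).
  move=> u j; rewrite E ltnS [j <= i]leq_eqVlt.
  by case: (u == n) => //=; case: (j =P i) => [->|].
move=> t1 rho1 M1 F [t1le [r10 E]] F'.
have r51 : rho1 5 = a by rewrite F.
have r61 : rho1 6 = b by rewrite F.
have r71 : rho1 7 = c by rewrite F.
eapply (wp_put w_large); [by evalue w_large..|by rewrite /low|by rewrite /stride; lia|].
split=> //; first by move: t1le => /=; lia.
move=> u j; rewrite /upd2 !E (ltn_eqF an) (ltn_eqF bn) (ltn_eqF cn) /=.
rewrite (enc a) // (enc b) // (enc c) //.
case: (u == n) => //=; rewrite [j <= n]leq_eqVlt; case: (j =P n) => [->|] //=.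
by rewrite /r /residual eqxx; case: (A a n) (A b n) (A c n) => [] [] [].
Qed.

Lemma wp_eliminate A (r : nat -> bool) p t rho M :
  p < n -> rho 10 = p -> encodes M A -> (forall j, j <= n -> M n j = r j) ->
  wp eliminate_cmd
    (fun t1 rho1 M1 => t1 <= t + 200 * (n * n) /\
       forall u j, M1 u j =
         if (u < n) && (j <= n) then nat_of_bool (eliminate r p A u j) else M u j)
    t rho M.
Proof.
move=> pn r10 enc Mr; apply: wp_conseq.
  apply: (wp_for_const w_large (N := n) (K := 40 * n + 100) (J := fun i _ M1 =>
    forall u j, M1 u j = if (u < i) && (j <= n)
      then nat_of_bool (eliminate r p A u j) else M u j)) => //.
  - exact: ev_n.
  move=> i t1 rho1 M1 iN r8 F E.
  have r101 : rho1 10 = p by rewrite F.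
  apply: wp_seq; eapply wp_set; [by evalue w_large|by []|move=> _].
  rewrite E ltnn /= enc //; last exact: ltnW.
  apply: wp_conseq.
    apply: (wp_for_const w_large (N := n + 1) (K := 30) (J := fun k _ M2 =>
      forall u j, M2 u j = if (u == i) && (j < k)
        then nat_of_bool (eliminate r p A u j) else M1 u j)) => //.
    - by move=> rho' M'; apply: ev_field.
    - by move=> u j; rewrite ltn0 andbF.
    move=> j t2 rho2 M2 jn r9 F2 E2.
    have r82 : rho2 8 = i by rewrite F2.
    have r112 : rho2 11 = A i p by rewrite F2.
    eapply (wp_put w_large);
      [by evalue w_large| by evalue w_large| | by rewrite /low; lia |by rewrite /stride; lia|].
      by evalue w_large; rewrite leq_b1.
    split; first by rewrite /=; lia.
    have jn' : j <= n by lia.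
    have cell_ij : M2 i j = A i j by rewrite E2 ltnn andbF E ltnn /= enc.
    have cell_nj : M2 n j = r j.
      by rewrite E2 (gtn_eqF iN) /= E ltnNge ltnW //= Mr.
    move=> u k; rewrite /upd2 cell_ij cell_nj E2 ltnS [k <= j]leq_eqVlt.
    case: (u =P i) => //= ->; case: (k =P j) => //= ->.
    by rewrite /eliminate; case: (A i j) (A i p) (r j) => [] [] [].
  move=> t2 rho2 M2 _ [t2le E2]; split.
    by move: t2le => /=; lia.
  move=> u j; rewrite E2 addn1 !ltnS E [u <= i]leq_eqVlt.
  by case: (u =P i) => [->|] //=; rewrite ltnn; case: (j <= n).
move=> t1 rho1 M1 _ [t1le E1]; split=> //.
by move: t1le => /=; have := leq_mul n_gt3 (leqnn n); nia.
Qed.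

Definition fresh M : Prop := forall v, v < n -> M v (n + 4) = 0.

(** An elimination costs at most [200 * n ^ 2], which is what it takes off the
    potential. *)
Lemma wp_impose A i t rho M (A' := impose n A (ea i) (eb i) (ec i)) :
  i < m -> rho 4 = i -> stores_edges M -> fresh M -> encodes M A ->
  wp impose_cmd
    (fun t1 rho1 M1 =>
       [/\ t1 + 200 * (n * n) * nonzero_columns n A' <=
             t + 300 * n + 200 * (n * n) * nonzero_columns n A,
           stores_edges M1, fresh M1 & encodes M1 A']) t rho M.
Proof.
move=> im r4 inp fr enc; have [an bn cn] := edges_lt im.
apply: wp_seq; apply: (wp_load_edge im r4 inp) => _.
apply: wp_seq; apply: wp_conseq.
  by apply: (wp_load_residual (A := A) (a := ea i) (b := eb i) (c := ec i)).
set r := residual n A (ea i) (eb i) (ec i).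
move=> t1 rho1 M1 _ [t1le r10 E1] _.
have keep u j : n < u \/ n < j -> M1 u j = M u j.
  move=> h; rewrite E1; case: andP => //; lia.
have inp1 : stores_edges M1 by move=> k km; rewrite !keep; auto.
have fr1 : fresh M1 by move=> v vn; rewrite keep ?fr //; right; lia.
have enc1 : encodes M1 A by move=> v j vn jn; rewrite E1 (ltn_eqF vn) enc.
apply: (wp_if w_large (b := last_true r n n < n)); first by evalue w_large.
  move=> pn; apply: wp_conseq.
    apply: (wp_eliminate (A := A) (r := r) _ pn) => //.
    by move=> j jn; rewrite E1 eqxx jn.
  move=> t2 rho2 M2 _ [t2le E2].
  have keep2 u j : n <= u \/ n < j -> M2 u j = M1 u j.
    by move=> h; rewrite E2; case: andP => //; lia.
  have A'E : A' = eliminate r (last_true r n n) A by rewrite /A' /impose -/r pn.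
  have rp : r (last_true r n n) by move: pn; case: last_trueP => [|//]; rewrite ltnn.
  have := nonzero_columns_eliminate an bn cn pn rp; rewrite -A'E => dec.
  split.
  - have /(leq_mul (leqnn (200 * (n * n)))) := dec; rewrite mulnS.
    by move: t1le t2le => /=; lia.
  - by move=> k km; rewrite !keep2; auto.
  - by move=> v vn; rewrite keep2 ?fr1 //; right; lia.
  - by move=> v j vn jn; rewrite E2 vn jn A'E.
move=> pn; apply: wp_skip.
have -> : A' = A by rewrite /A' /impose -/r (negbTE pn).
by split=> //; move: t1le => /=; lia.
Qed.

Notation A := (solved n ea eb ec m).

Lemma wp_solve t rho M :
  stores_edges M -> (forall v j, v < n -> j < stride n -> M v j = 0) ->
  wp solve_cmd
    (fun t1 rho1 M1 =>
       [/\ t1 <= t + 400 * (n * n * n) + 400 * (n * m) + 100,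
           stores_edges M1, fresh M1 & encodes M1 A]) t rho M.
Proof.
move=> inp M0; apply: wp_seq; apply: wp_conseq.
  apply: (wp_for_const w_large (N := n) (K := 30) (J := fun i _ M1 =>
    forall u j, M1 u j = if (u < i) && (j == u) then 1 else M u j)) => //.
  - exact: ev_n.
  move=> i t1 rho1 M1 iN r8 F E.
  eapply (wp_put w_large);
    [by evalue w_large..| by rewrite /low; lia |by rewrite /stride; lia|].
  split; first by rewrite /=; lia.
  move=> u j; rewrite /upd2 E ltnS [u <= i]leq_eqVlt.
  by case: (u =P i) => [->|] //=; rewrite ltnn; case: (j == i).
move=> t1 rho1 M1 F1 [t1le E1] _.
pose J i t' (_ : regs) M' := [/\ t' + 200 * (n * n) * nonzero_columns n (solved n ea eb ec i)
   <= t + 50 * n + 50 + 350 * (i * n) + 200 * (n * n) * n,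
   stores_edges M', fresh M' & encodes M' (solved n ea eb ec i)].
apply: (wp_for w_large (N := m) (J := J)) => //.
- exact: ev_m.
- split.
  + have := nonzero_columns_le n (solved n ea eb ec 0).
    move=> /(leq_mul (leqnn (200 * (n * n)))).
    by move: t1le => /=; lia.
  + move=> k km; rewrite !E1.
    rewrite (_ : (low n < n) = false) /=; [exact: inp|by rewrite /low; lia].
  + move=> v vn; rewrite E1 (_ : (n + 4 == v) = false) ?andbF; last by lia.
    by rewrite M0 // /stride; lia.
  + move=> v j vn jn; rewrite E1 vn /= eq_sym; case: eqP => //= _.
    by rewrite M0 // /stride; lia.
- move=> i t2 rho2 M2 im r4 _ [t2le inp2 fr2 enc2].
  apply: wp_conseq; first exact: (wp_impose _ im r4 inp2 fr2 enc2).
  move=> t3 rho3 M3 _ [t3le inp3 fr3 enc3]; split=> //.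
  by move: t3le t2le => /=; rewrite mulSn; lia.
move=> t2 rho2 M2 [t2le inp2 fr2 enc2]; split=> //.
by move: t2le => /=; nia.
Qed.

End Elim.

(** * Rounds *)

Section Rounds.

Variables n m w : nat.
Hypothesis n_gt3 : 3 < n.
Hypothesis w_large : base n m + low n * stride n + 100 <= 2 ^ w.

Notation ev := (ev n m w).
Notation wp := (wp n m w).

Variables ea eb ec : nat -> nat.
Hypothesis edges_lt : forall i, i < m -> [/\ ea i < n, eb i < n & ec i < n].

Notation A := (solved n ea eb ec m).
Notation pivot := (pivot n m ea eb ec).
Notation rank := (rank n m ea eb ec).
Notation votes := (votes n m ea eb ec).
Notation greedy := (greedy n m ea eb ec).
Notation step_act := (step_act n m ea eb ec).
Notation step_col := (step_col n m ea eb ec).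
Notation stores_edges := (stores_edges n m ea eb ec).

Implicit Types (rho : regs) (M : table) (Q : post).
Implicit Types (act : nat -> bool) (col : nat -> nat).

(** The columns of the chosen solution and the rows [n] and [n + 1] are left
    free, as scratch space. *)
Record layout act col M : Prop := Layout {
  lay_edges : stores_edges M;
  lay_matrix : encodes n M A;
  lay_pivot : forall v, v < n -> M v (n + 1) = pivot v;
  lay_act : forall v, v < n -> M v (n + 3) = act v;
  lay_col : forall v, v < n -> M v (n + 4) = col v }.

Lemma rank_leq act k : rank act k <= k.
Proof.
rewrite -[X in _ <= X]card_ord -sum1_card; apply: leq_sum => v _.
exact: leq_b1.
Qed.

Lemma rankS act k : rank act k.+1 = rank act k + (act k && (pivot k < n)).
Proof. by rewrite /rank big_ord_recr. Qed.

Lemma votes_leq act X f k b : votes act X f k b <= k.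
Proof.
rewrite -[X in _ <= X]card_ord -sum1_card; apply: leq_sum => v _.
exact: leq_b1.
Qed.

Lemma votesS act X f k b :
  votes act X f k.+1 b = votes act X f k b + [&& act k, pivot k == f & X k == b].
Proof. by rewrite /votes big_ord_recr. Qed.

Lemma wp_analyse t rho M :
  stores_edges M -> fresh n M -> encodes n M A ->
  wp analyse_cmd
    (fun t1 rho1 M1 => [/\ t1 <= t + 200 * (n * n), rho1 15 = rank xpredT n &
       layout xpredT (fun=> 0) M1]) t rho M.
Proof.
move=> inp fr enc.
apply: wp_seq; eapply wp_set; [by evalue w_large|by []|move=> _].
pose J i M' := forall u j, M' u j =
  if (u < i) && (j == n + 1) then pivot u else
  if (u < i) && (j == n + 3) then 1 else M u j.
apply: wp_conseq.
  apply: (wp_for_const w_large (N := n) (K := 70 * n + 100) (J := fun i rho1 M1 =>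
    rho1 15 = rank xpredT i /\ J i M1)) => //.
  - exact: ev_n.
  - by split; [rewrite /rank big_ord0|].
  move=> i t1 rho1 M1 iN r8 F [r15 E].
  apply: wp_seq; eapply (wp_put w_large);
    [by evalue w_large..|by rewrite /low; lia|by rewrite /stride; lia|move=> _].
  apply: wp_seq; apply: wp_conseq.
    apply: (wp_for_const w_large (N := n) (K := 50) (J := fun k _ M2 =>
      forall u j, M2 u j = if (u == i) && (j == n + 1)
        then last_true (A i) n k else M1 u j)) => //.
    - exact: ev_n.
    move=> j t2 rho2 M2 jn r9 F2 E2.
    have r82 : rho2 8 = i by rewrite F2.
    have cell : M2 i j = A i j.
      rewrite E2 eqxx (_ : (j == n + 1) = false) /= ?E ?ltnn /=; last by lia.
      by rewrite enc // ltnW.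
    eapply (wp_put w_large);
      [by evalue w_large|by evalue w_large| |by rewrite /low; lia|by rewrite /stride; lia|].
      by evalue w_large; rewrite cell leq_b1.
    split; first by rewrite /=; lia.
    move=> u k; rewrite /upd2 cell !E2 !eqxx /=.
    by case: andP => // _; case: (A i j).
  move=> t2 rho2 M2 F2 [t2le E2] F2'.
  have r82 : rho2 8 = i by rewrite F2.
  have r152 : rho2 15 = rank xpredT i by rewrite F2.
  apply: wp_seq; eapply (wp_put w_large);
    [by evalue w_large..|by rewrite /low; lia|by rewrite /stride; lia|move=> _].
  eapply wp_set; [evalue w_large|by []|].
    set b := (X in _ + X); have : b <= 1 by rewrite leq_b1.
    by have := rank_leq xpredT i; move: w_large; rewrite /base; lia.
  split; first by move: t2le => /=; lia.
  have piv : pivot i = last_true (A i) n n by [].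
  split.
    rewrite /upd /= rankS /upd2 E2 (_ : (n + 1 == n + 3) = false); last by lia.
    by rewrite !eqxx /= -piv.
  move=> u j; rewrite /upd2 E2 E !ltnS [u <= i]leq_eqVlt.
  case: (u =P i) => [->|_] //=; rewrite ltnn /=.
  case: (j =P n + 3) => [->|_]; last by case: ifP.
  by rewrite (_ : (n + 3 == n + 1) = false) //; lia.
move=> t1 rho1 M1 _ [t1le [r15 E]]; split=> //.
  by move: t1le => /=; have := leq_mul n_gt3 (leqnn n); nia.
split.
- move=> i im; rewrite !E (_ : (low n < n) = false) /=; first exact: inp.
  by rewrite /low; lia.
- move=> v j vn jn; rewrite E (_ : (j == n + 1) = false); last by lia.
  by rewrite (_ : (j == n + 3) = false) ?andbF /= ?enc //; lia.
- by move=> v vn; rewrite E vn eqxx.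
- by move=> v vn; rewrite E vn eqxx (_ : (n + 3 == n + 1) = false) //; lia.
- move=> v vn; rewrite E vn (_ : (n + 4 == n + 1) = false) /=; last by lia.
  by rewrite (_ : (n + 4 == n + 3) = false) /= ?fr //; lia.
Qed.

Lemma layout_put2 act col M v x :
  v < n -> layout act col M -> layout act col (upd2 M v (n + 2) x).
Proof.
move=> vn [l1 l2 l3 l4 l5]; have h u j : j != n + 2 \/ n <= u ->
    upd2 M v (n + 2) x u j = M u j.
  by move=> h; rewrite /upd2; case: andP => // -[/eqP uv /eqP jj]; lia.
split=> [i im|u j un jn|u un|u un|u un].
- by rewrite !h; [exact: l1|right; rewrite /low; lia..].
- by rewrite h ?l2 //; left; lia.
- by rewrite h ?l3 //; left; lia.
- by rewrite h ?l4 //; left; lia.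
- by rewrite h ?l5 //; left; lia.
Qed.

Definition scratch (X : nat -> bool) M := forall v, v < n -> M v (n + 2) = X v.

Lemma wp_count_votes act col X f t rho M :
  f < n -> rho 12 = f -> layout act col M -> scratch X M ->
  wp count_votes
    (fun t1 rho1 M1 => [/\ t1 <= t + 100 * n, rho1 13 = votes act X f n false,
       rho1 14 = votes act X f n true & M1 = M]) t rho M.
Proof.
move=> fn r12 lay sX.
do 2![apply: wp_seq; eapply wp_set; [by evalue w_large|by []|move=> _]].
apply: wp_conseq.
  apply: (wp_for_const w_large (N := n) (K := 80) (J := fun i rho1 M1 =>
    [/\ rho1 13 = votes act X f i false, rho1 14 = votes act X f i true & M1 = M])) => //.
  - exact: ev_n.
  - by rewrite /votes !big_ord0.
  move=> i t1 rho1 M1 iN r8 F [r13 r14 ->].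
  have r121 : rho1 12 = f by rewrite F.
  apply: wp_seq; eapply wp_set; [evalue w_large|by []|move=> _].
    by rewrite (lay_act lay) // leq_b1.
  rewrite (lay_act lay) // (lay_pivot lay) // mulnb.
  apply: wp_seq; eapply wp_set; [evalue w_large|by []|move=> _].
    rewrite mulnb; move: (leq_b1 (act i && (pivot i == f) && (M i (n + 2) == 0))).
    by have := votes_leq act X f i false; move: w_large; rewrite /base; lia.
  eapply wp_set; [evalue w_large|by []|].
    rewrite sX // mulnb; move: (leq_b1 (act i && (pivot i == f) && X i)).
    by have := votes_leq act X f i true; move: w_large; rewrite /base; lia.
  split; first by rewrite /=; lia.
  rewrite /upd /= !votesS sX // !mulnb -!andbA; split=> //.
    by case: (X i).
  by case: (X i).
move=> t1 rho1 M1 _ [t1le [r13 r14 ->]]; split=> //.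
by move: t1le => /=; lia.
Qed.

Lemma wp_flip act col X f t rho M :
  f < n -> rho 12 = f -> layout act col M -> scratch X M ->
  wp flip_cmd
    (fun t1 rho1 M1 => [/\ t1 <= t + 100 * n, layout act col M1 &
       scratch (fun v => X v (+) A v f) M1]) t rho M.
Proof.
move=> fn r12 lay sX; apply: wp_conseq.
  apply: (wp_for_const w_large (N := n) (K := 80) (J := fun i _ M1 =>
    layout act col M1 /\
    forall u, u < n -> M1 u (n + 2) = if u < i then X u (+) A u f else X u)) => //.
  - exact: ev_n.
  move=> i t1 rho1 M1 iN r8 F [lay1 E].
  have r121 : rho1 12 = f by rewrite F.
  eapply (wp_put w_large);
    [by evalue w_large..|by rewrite /low; lia|by rewrite /stride; lia|].
  split; first by rewrite /=; lia.
  split; first exact: layout_put2.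
  move=> u un; rewrite /upd2 E // (lay_matrix lay1) ?(ltnW fn) // ltnn eqxx andbT.
  rewrite ltnS [u <= i]leq_eqVlt; case: (u =P i) => [->|_] /=; last exact: E.
  by case: (X i) (A i f) => [] [].
move=> t1 rho1 M1 _ [t1le [lay1 E]]; split=> //; first by move: t1le => /=; lia.
by move=> u un; rewrite E // un.
Qed.

Lemma wp_greedy act col t rho M :
  layout act col M ->
  wp greedy_cmd
    (fun t1 rho1 M1 => [/\ t1 <= t + 400 * (n * n), layout act col M1 &
       scratch (greedy act n) M1]) t rho M.
Proof.
move=> lay; apply: wp_seq; apply: wp_conseq.
  apply: (wp_for_const w_large (N := n) (K := 50) (J := fun i _ M1 =>
    layout act col M1 /\ forall u, u < i -> M1 u (n + 2) = A u n)) => //.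
  - exact: ev_n.
  move=> i t1 rho1 M1 iN r8 F [lay1 E].
  eapply (wp_put w_large);
    [by evalue w_large..|by rewrite /low; lia|by rewrite /stride; lia|].
  split; first by rewrite /=; lia.
  split; first exact: layout_put2.
  move=> u; rewrite ltnS leq_eqVlt /upd2 eqxx andbT; case: (u =P i) => [->|_] /=.
    by rewrite (lay_matrix lay1).
  exact: E.
move=> t1 rho1 M1 _ [t1le [lay1 E]] _; apply: wp_conseq.
  apply: (wp_for_const w_large (N := n) (K := 250 * n) (J := fun f _ M2 =>
    layout act col M2 /\ scratch (greedy act f) M2)) => //.
  - exact: ev_n.
  move=> f t2 rho2 M2 fn r12 F [lay2 sX].
  apply: wp_seq; apply: wp_conseq; first exact: (wp_count_votes _ fn r12 lay2 sX).
  move=> t3 rho3 M3 F3 [t3le r13 r14 ->] _.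
  have r123 : rho3 12 = f by rewrite F3.
  set y := votes act (greedy act f) f n false < votes act (greedy act f) f n true.
  apply: (wp_if w_large (b := y)); first by evalue w_large.
    move=> yT; apply: wp_conseq; first exact: (wp_flip _ fn r123 lay2 sX).
    move=> t4 rho4 M4 _ [t4le lay4 sX4]; split; first by move: t4le => /=; lia.
    by split=> // v vn; rewrite sX4 //= -/y yT andbT.
  move=> yF; apply: wp_skip; split; first by rewrite /=; lia.
  by split=> // v vn; rewrite sX //= -/y (negbTE yF) andbF addbF.
move=> t2 rho2 M2 _ [t2le [lay2 sX]]; split=> //.
by move: t1le t2le => /=; have := leq_mul n_gt3 (leqnn n); nia.
Qed.

Lemma wp_retire act col r t rho M :
  rho 16 = r -> (forall v, v < n -> step_col act r col v < n) ->
  layout act col M -> scratch (greedy act n) M ->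
  wp retire_cmd
    (fun t1 rho1 M1 => [/\ t1 <= t + 200 * n, rho1 15 = rank (step_act act) n &
       layout (step_act act) (step_col act r col) M1]) t rho M.
Proof.
move=> r16 coln lay sX.
apply: wp_seq; eapply wp_set; [by evalue w_large|by []|move=> _].
pose J i M' := forall u j, M' u j =
  if (u < i) && (j == n + 4) then step_col act r col u else
  if (u < i) && (j == n + 3) then nat_of_bool (step_act act u) else M u j.
apply: wp_conseq.
  apply: (wp_for_const w_large (N := n) (K := 150) (J := fun i rho1 M1 =>
    rho1 15 = rank (step_act act) i /\ J i M1)) => //.
  - exact: ev_n.
  - by split; [rewrite /rank big_ord0|].
  move=> i t1 rho1 M1 iN r8 F [r15 E].
  have r161 : rho1 16 = r by rewrite F.
  have E1 j : M1 i j = M i j by rewrite E ltnn.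
  have colE : M1 i (n + 4) + M1 i (n + 3) * (M1 i (n + 2) == 0) * r
      = step_col act r col i.
    rewrite !E1 (lay_col lay) // (lay_act lay) // sX // /step_col mulnC.
    by rewrite mulnb; case: (greedy _ _ _).
  have ne34 : (n + 3 == n + 4) = false by lia.
  have ne24 : (n + 2 == n + 4) = false by lia.
  have ne14 : (n + 1 == n + 4) = false by lia.
  have ne13 : (n + 1 == n + 3) = false by lia.
  apply: wp_seq; eapply (wp_put w_large);
    [by evalue w_large|by evalue w_large| |by rewrite /low; lia|by rewrite /stride; lia|move=> _].
    evalue w_large.
    + by rewrite E1 (lay_act lay) // leq_b1.
    + by rewrite E1 (lay_act lay) // mulnb leq_b1.
    + by rewrite colE; have := coln i iN; move: w_large; rewrite /base; lia.
  rewrite colE.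
  apply: wp_seq; eapply (wp_put w_large);
    [by evalue w_large|by evalue w_large| |by rewrite /low; lia|by rewrite /stride; lia|move=> _].
    evalue w_large.
    by rewrite /upd2 ne34 andbF E1 (lay_act lay) // leq_b1.
  have -> : upd2 M1 i (n + 4) (step_col act r col i) i (n + 3) *
     upd2 M1 i (n + 4) (step_col act r col i) i (n + 2) = step_act act i.
    by rewrite /upd2 ne34 ne24 !andbF !E1 (lay_act lay) // sX // mulnb.
  set M2 := upd2 _ _ _ _.
  have M2a : M2 i (n + 3) = step_act act i by rewrite /M2 /upd2 !eqxx.
  have M2p : M2 i (n + 1) = pivot i.
    by rewrite /M2 /upd2 ne13 ne14 !andbF E1 (lay_pivot lay).
  eapply wp_set; [evalue w_large|by []|].
    rewrite M2a M2p mulnb; move: (leq_b1 (step_act act i && (pivot i < n))).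
    by have := rank_leq (step_act act) i; move: w_large; rewrite /base; lia.
  split; first by rewrite /=; lia.
  rewrite M2a M2p mulnb /upd /=; split; first by rewrite rankS.
  move=> u j; rewrite /M2 /upd2 E !ltnS [u <= i]leq_eqVlt.
  case: (u =P i) => [->|_] //=; rewrite ltnn /=.
  by case: (j =P n + 3) => [->|_] //=; rewrite ne34.
move=> t1 rho1 M1 _ [t1le [r15 E]]; split=> //; first by move: t1le => /=; lia.
split.
- move=> i im; rewrite !E (_ : (low n < n) = false) /=; first exact: (lay_edges lay).
  by rewrite /low; lia.
- move=> v j vn jn; rewrite E (_ : (j == n + 4) = false); last by lia.
  by rewrite (_ : (j == n + 3) = false) ?andbF /= ?(lay_matrix lay) //; lia.
- move=> v vn; rewrite E vn (_ : (n + 1 == n + 4) = false) /=; last by lia.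
  by rewrite (_ : (n + 1 == n + 3) = false) /= ?(lay_pivot lay) //; lia.
- by move=> v vn; rewrite E vn eqxx (_ : (n + 3 == n + 4) = false) //; lia.
- by move=> v vn; rewrite E vn eqxx.
Qed.

Variable x : nat -> bool.
Hypothesis one_in_three :
  forall i, i < m -> x (ea i) + x (eb i) + x (ec i) = 1.

Notation settled := (settled n m ea eb ec).

Definition rounds_done (r : nat) act col rho M : Prop :=
  [/\ rho 16 = r, rho 15 = rank act n, layout act col M, settled act col r &
      2 ^ r.+2 <= n].

Lemma wp_round r act col t rho M :
  rounds_done r act col rho M ->
  wp round_cmd
    (fun t1 rho1 M1 => [/\ t1 <= t + 500 * (n * n), rho1 16 = r.+1,
       rho1 15 = rank (step_act act) n,
       layout (step_act act) (step_col act r col) M1 &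
       settled (step_act act) (step_col act r col) r.+1]) t rho M.
Proof.
case=> r16 r15 lay st rn.
have r_lt_n : r.+2 < n by apply: leq_trans rn; apply: ltn_expl.
have st' := settled_step edges_lt one_in_three st.
apply: wp_seq; apply: wp_conseq; first exact: (wp_greedy _ lay).
move=> t1 rho1 M1 F1 [t1le lay1 sX] _.
have r161 : rho1 16 = r by rewrite F1.
apply: wp_seq; apply: wp_conseq.
  apply: (wp_retire _ r161 _ lay1 sX) => v vn.
  case: st => s1 s2 _; rewrite /step_col; have := s2 v vn; have := s1 v.
  by case: (act v) (greedy _ _ _) => [] [] /=; lia.
move=> t2 rho2 M2 F2 [t2le r152 lay2] _.
have r162 : rho2 16 = r by rewrite F2.
eapply wp_set; [by evalue w_large|by []|].
split=> //; last by rewrite /upd /= addn1.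
by move: t1le t2le => /=; have := leq_mul n_gt3 (leqnn n); nia.
Qed.

(** At most [n] rounds take place, because each one lowers the number of active
    vertices with a non-constant form; this crude bound already gives [O(n^3)].
    The bound [2 ^ (r + 2) <= n] comes from halving: [8 <= rank act n] and
    [rank act n * 2 ^ r <= n] when a round starts. *)
Lemma wp_rounds t rho M :
  rho 15 = rank xpredT n -> layout xpredT (fun=> 0) M ->
  wp rounds_cmd
    (fun t1 rho1 M1 => t1 <= t + 600 * (n * n * n) /\
       exists r act col, rounds_done r act col rho1 M1 /\ rank act n < 8) t rho M.
Proof.
move=> r15 lay; apply: wp_seq; eapply wp_set; [by evalue w_large|by []|move=> _].
apply: (wp_while w_large (N := n) (J := fun k t' rho' M' =>
   t' + k * (500 * (n * n) + 5) <= t + 2 + n * (500 * (n * n) + 5) /\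
   exists r act col, [/\ rounds_done r act col rho' M', rank act n * 2 ^ r <= n &
     rank act n <= k])).
  split; first by rewrite /=; lia.
  exists 0, xpredT, (fun=> 0); split; last exact: rank_leq.
    by split=> //; exact: settled_start.
  by rewrite expn0 muln1 rank_leq.
move=> k t' rho' M' _ [t'le [r [act [col [rd half lek]]]]].
have [r16 r15' lay' st rn] := rd.
exists (7 < rank act n); first by evalue w_large.
case: ltnP => cnt.
  split; first by lia.
  apply: wp_conseq; first exact: (wp_round _ rd).
  move=> t1 rho1 M1 _ [t1le r161 r151 lay1 st1].
  have := rank_step n m ea eb ec act => hs; split.
    case: k lek t'le => [|k] lek t'le; first by lia.
    by move: t1le t'le => /=; rewrite mulSn; lia.
  exists r.+1, (step_act act), (step_col act r col); split.
  - split=> //; rewrite !expnS; have := leq_mul cnt (leqnn (2 ^ r)); lia.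
  - by rewrite expnS mulnA [_ * 2]mulnC; apply: leq_trans half; rewrite leq_mul2r hs orbT.
  - by lia.
split; last by exists r, act, col.
move: t'le => /=; have := leq_mul n_gt3 (leqnn n); nia.
Qed.

End Rounds.

(** * Search for the last two colours *)

Section Final.

Variables n m w : nat.
Hypothesis n_gt3 : 3 < n.
Hypothesis w_large : base n m + low n * stride n + 100 <= 2 ^ w.

Notation ev := (ev n m w).
Notation wp := (wp n m w).

Variables ea eb ec : nat -> nat.
Hypothesis edges_lt : forall i, i < m -> [/\ ea i < n, eb i < n & ec i < n].

Notation A := (solved n ea eb ec m).
Notation pivot := (pivot n m ea eb ec).
Notation rank := (rank n m ea eb ec).
Notation stores_edges := (stores_edges n m ea eb ec).
Notation layout := (layout n m ea eb ec).
Notation final_col := (final_col n m ea eb ec).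

Implicit Types (rho : regs) (M : table) (Q : post).

Definition all_unique_max (c : nat -> nat) (k : nat) : bool :=
  all (fun i => unique_max (c (ea i)) (c (eb i)) (c (ec i))) (iota 0 k).

Lemma all_unique_maxS c k :
  all_unique_max c k.+1 = all_unique_max c k && unique_max (c (ea k)) (c (eb k)) (c (ec k)).
Proof. by rewrite /all_unique_max -addn1 iotaD all_cat /= andbT. Qed.

Lemma eq_all_unique_max c1 c2 k : k <= m ->
  (forall v, v < n -> c1 v = c2 v) -> all_unique_max c1 k = all_unique_max c2 k.
Proof.
move=> km h; apply: eq_in_all => i; rewrite mem_iota => /andP[_ ik].
have [an bn cn] := edges_lt (leq_trans ik km).
by rewrite !h.
Qed.

Lemma ev_unique_max rho M x y z :
  rho 5 = x -> rho 6 = y -> rho 7 = z ->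
  ev rho M (Bin OpAdd (dominates 5 6 7)
             (Bin OpAdd (dominates 5 7 6) (dominates 6 7 5)))
     (unique_max x y z).
Proof.
move=> r5 r6 r7.
have val : (x < z) * (y < z) + ((x < y) * (z < y) + (y < x) * (z < x)) =
    unique_max x y z by rewrite /unique_max !mulnb; lia.
by rewrite /dominates -val; evalue w_large.
Qed.

Definition shows (c : nat -> nat) M := forall v, v < n -> M v (n + 4) = c v.

Lemma wp_output c t rho M :
  shows c M ->
  wp output_cmd
    (fun t1 rho1 M1 => t1 <= t + 50 * n /\ forall v, v < n -> M1 (low n) v = c v)
    t rho M.
Proof.
move=> sh; apply: wp_conseq.
  apply: (wp_for_const w_large (N := n) (K := 30) (J := fun i _ M1 =>
    shows c M1 /\ forall v, v < i -> M1 (low n) v = c v)) => //.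
  - exact: ev_n.
  move=> i t1 rho1 M1 iN r8 F [sh1 E].
  eapply (wp_store w_large);
    [by apply: ev_low; evalue w_large| |by evalue w_large|].
    by rewrite /valid eqxx /base; lia.
  split; first by rewrite /=; lia.
  split=> v.
    by move=> vn; rewrite /upd2 (_ : (v == low n) = false) ?sh1 //; rewrite /low; lia.
  rewrite ltnS leq_eqVlt /upd2 eqxx /=; case: (v =P i) => [->|_] /=; last exact: E.
  by rewrite sh1.
by move=> t1 rho1 M1 _ [t1le [_ E]]; split=> //; move: t1le => /=; lia.
Qed.

Lemma wp_check c t rho M :
  stores_edges M -> shows c M ->
  wp check_cmd
    (fun t1 rho1 M1 => [/\ t1 <= t + 120 * m + 20, rho1 17 = all_unique_max c m & M1 = M])
    t rho M.
Proof.
move=> inp sc; apply: wp_seq; eapply wp_set; [by evalue w_large|by []|move=> _].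
apply: wp_conseq.
  apply: (wp_for_const w_large (N := m) (K := 110) (J := fun i rho1 M1 =>
    rho1 17 = all_unique_max c i /\ M1 = M)) => //.
  - exact: ev_m.
  move=> i t1 rho1 M1 im r4 F [r17 ->].
  have [an bn cn] := edges_lt im.
  apply: wp_seq; apply: (wp_load_edge n_gt3 w_large im r4 inp) => _.
  apply: wp_seq; eapply wp_set; [by evalue w_large|by []|move=> _].
  apply: wp_seq; eapply wp_set; [by evalue w_large|by []|move=> _].
  apply: wp_seq; eapply wp_set; [by evalue w_large|by []|move=> _].
  rewrite !sc //.
  apply: (wp_set (x := all_unique_max c i * unique_max (c (ea i)) (c (eb i)) (c (ec i)))) => //.
    by apply: (ev_mul w_large); [evalue w_large|exact: ev_unique_max|exact: leq_b1].
  split; first by rewrite /=; lia.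
  by rewrite /upd /= all_unique_maxS mulnb.
move=> t1 rho1 M1 _ [t1le [r17 ->]]; split=> //.
by move: t1le => /=; lia.
Qed.

(** What repeated colourings leave unchanged: the colours of active vertices are
    rewritten by every guess, those of retired vertices never. *)
Record canvas (act : nat -> bool) (col : nat -> nat) M : Prop := Canvas {
  can_edges : stores_edges M;
  can_matrix : forall v, v < n -> M v n = A v n;
  can_pivot : forall v, v < n -> M v (n + 1) = pivot v;
  can_act : forall v, v < n -> M v (n + 3) = act v;
  can_col : forall v, v < n -> ~~ act v -> M v (n + 4) = col v }.

Variables (act : nat -> bool) (col : nat -> nat) (r : nat).
Hypothesis r_lt_n : r.+2 < n.
Hypothesis few_left : rank act n < 8.

Definition bits_at (k : nat) (bits : nat -> bool) M :=
  forall j, k <= j < 8 -> M (n + 1) j = bits j.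

Lemma eq_final_col bits1 bits2 :
  (forall j, j < 8 -> bits1 j = bits2 j) ->
  forall v, v < n -> final_col act col r bits1 v = final_col act col r bits2 v.
Proof.
move=> h v vn; rewrite /final_col h //; apply: leq_ltn_trans few_left.
exact/rank_le/ltnW.
Qed.

Lemma wp_paint bits t rho M :
  rho 16 = r -> canvas act col M -> bits_at 0 bits M ->
  wp paint_cmd
    (fun t1 rho1 M1 => [/\ t1 <= t + 170 * n, canvas act col M1,
       bits_at 0 bits M1 & shows (final_col act col r bits) M1]) t rho M.
Proof.
move=> r16 can hb.
apply: wp_seq; eapply wp_set; [by evalue w_large|by []|move=> _].
apply: wp_conseq.
  apply: (wp_for_const w_large (N := n) (K := 150) (J := fun i rho1 M1 =>
    rho1 18 = rank act i /\
    forall u j, M1 u j = if (u < i) && (j == n + 4)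
      then final_col act col r bits u else M u j)) => //.
  - exact: ev_n.
  - by split; [rewrite /rank big_ord0|].
  move=> i t1 rho1 M1 iN r8 F [r18 E].
  have r161 : rho1 16 = r by rewrite F.
  have E1 j : M1 i j = M i j by rewrite E ltnn.
  have Eb j : M1 (n + 1) j = M (n + 1) j.
    by rewrite E (_ : (n + 1 < i) = false) //; lia.
  have rk : rank act i < 8.
    by apply: leq_ltn_trans few_left; apply/rank_le/ltnW.
  apply: wp_seq; eapply (wp_put w_large);
    [by evalue w_large|by evalue w_large| |by rewrite /low; lia|by rewrite /stride; lia|move=> _].
    evalue w_large; first by rewrite E1 (can_act can) // leq_b1.
    rewrite !E1 Eb hb // (can_matrix can) // (can_pivot can) //.
    have: (if (pivot i < n) == 0 :> nat then A i n : nat else bits (rank act i)) <= 1.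
      by case: eqP => _; exact: leq_b1.
    by move: w_large; rewrite /base; lia.
  have ne14 : (n + 1 == n + 4) = false by lia.
  have ne34 : (n + 3 == n + 4) = false by lia.
  set z := (X in upd2 _ _ _ X).
  have zE : z = final_col act col r bits i.
    rewrite /z !E1 Eb hb // (can_matrix can) // (can_pivot can) // (can_act can) //.
    rewrite /final_col; case: (boolP (act i)) => [ai|nai] /=; last exact: (can_col can).
    by case: (pivot i < n).
  rewrite zE; set M2 := upd2 _ _ _ _.
  have M2a : M2 i (n + 3) = act i by rewrite /M2 /upd2 ne34 andbF E1 (can_act can).
  have M2p : M2 i (n + 1) = pivot i by rewrite /M2 /upd2 ne14 andbF E1 (can_pivot can).
  eapply wp_set; [by evalue w_large|by []|].
  split; first by rewrite /=; lia.
  rewrite M2a M2p mulnb /upd /=; split; first by rewrite rankS.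
  move=> u j; rewrite /M2 /upd2 E !ltnS [u <= i]leq_eqVlt.
  by case: (u =P i) => [->|_] //=; rewrite ltnn /=.
move=> t1 rho1 M1 _ [t1le [_ E]].
have keep u j : n <= u \/ j != n + 4 -> M1 u j = M u j.
  by move=> h; rewrite E; case: andP => // -[un /eqP jn]; lia.
have low_n : n <= low n by rewrite /low; lia.
have sh : shows (final_col act col r bits) M1.
  by move=> v vn; rewrite E vn eqxx.
split=> //; first by move: t1le => /=; lia.
  split=> [i im|v vn|v vn|v vn|v vn av].
  - by rewrite !keep; [exact: (can_edges can)|left..].
  - by rewrite keep ?(can_matrix can) //; right; lia.
  - by rewrite keep ?(can_pivot can) //; right; lia.
  - by rewrite keep ?(can_act can) //; right; lia.
  - by rewrite sh // /final_col (negbTE av).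
by move=> j j8; rewrite keep ?hb //; left; lia.
Qed.

Lemma set_bit_canvas k b M : canvas act col M -> canvas act col (upd2 M (n + 1) k b).
Proof.
have h v j : v < n -> upd2 M (n + 1) k b v j = M v j.
  by move=> vn; rewrite /upd2 (_ : (v == n + 1) = false) //; lia.
case=> c1 c2 c3 c4 c5; split=> [i im|v vn|v vn|v vn|v vn av].
- by rewrite /upd2 (_ : (low n == n + 1) = false) /=; [exact: c1|rewrite /low; lia].
- by rewrite h ?c2.
- by rewrite h ?c3.
- by rewrite h ?c4.
- by rewrite h ?c5.
Qed.

(** Bits from [k] on are given; the search reports a success only with the
    colouring in place, and it does report one if some completion succeeds. *)
Definition search_outcome k bits rho M : Prop :=
  exists ok : bool,
    [/\ rho 17 = ok,
        ok -> exists bits', all_unique_max (final_col act col r bits') m /\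
                            shows (final_col act col r bits') M &
        forall bits', (forall j, k <= j < 8 -> bits' j = bits j) ->
          all_unique_max (final_col act col r bits') m -> ok].

(** The slack of 50 on the left pays for the instructions between the two
    recursive calls, so that the bound can simply double. *)
Lemma wp_search k bits t rho M :
  k <= 8 -> rho 16 = r -> canvas act col M -> bits_at k bits M ->
  wp (search_cmd k)
    (fun t1 rho1 M1 => [/\ t1 + 50 <= t + 2 ^ k * (200 * n + 200 * m + 100),
       rho1 16 = r, canvas act col M1, bits_at k bits M1 & search_outcome k bits rho1 M1])
    t rho M.
Proof.
elim: k bits t rho M => [|k IH] bits t rho M k8 r16 can hb.
  apply: wp_seq; apply: wp_conseq; first exact: (wp_paint _ r16 can hb).
  move=> t1 rho1 M1 F1 [t1le can1 hb1 sh1] _.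
  apply: wp_conseq; first exact: (wp_check _ (can_edges can1) sh1).
  move=> t2 rho2 M2 F2 [t2le r17 ->]; split=> //.
  - by rewrite expn0 mul1n; lia.
  - by rewrite F2 ?F1.
  exists (all_unique_max (final_col act col r bits) m); split=> // [gd|bits' hbits gd].
    by exists bits.
  rewrite (eq_all_unique_max (c2 := final_col act col r bits')) // => v vn.
  by apply: eq_final_col => // j j8; rewrite hbits.
rewrite /=; have {}IH := fun bits t rho M => IH bits t rho M (ltnW k8).
have set_ok b (bits' := fun j => if j == k then b else bits j) M' :
    bits_at k.+1 bits M' -> bits_at k bits' (upd2 M' (n + 1) k (nat_of_bool b)).
  move=> h j /andP[kj j8]; rewrite /upd2 /bits' eqxx; case: eqP => //= jk.
  by apply: h; lia.
have relax b M' (bits' := fun j => if j == k then b else bits j) :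
    bits_at k bits' M' -> bits_at k.+1 bits M'.
  by move=> h j /andP[kj j8]; rewrite h /bits' ?(gtn_eqF kj) //; lia.
have k100 : k < 100 by lia.
have kst : k < stride n by rewrite /stride; lia.
have set_wp (b : bool) Q t' rho' M' :
    Q (t' + 11) rho' (upd2 M' (n + 1) k b) -> wp (set_bit k b) Q t' rho' M'.
  move=> q; eapply (wp_put w_large); [by evalue w_large|exact: ev_const|
     apply: ev_const => //; case: (b) => //|by rewrite /low; lia|exact: kst|exact: q].
apply: wp_seq; apply: (set_wp false) => _.
apply: wp_seq; apply: wp_conseq.
  exact: (IH _ _ _ _ r16 (set_bit_canvas _ _ can) (set_ok false _ hb)).
move=> t1 rho1 M1 F1 [t1le r161 can1 hb1 [ok1 [r17 yes1 no1]]] _.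
have hb1' := relax _ _ hb1.
apply: (wp_if w_large (b := ok1)); first by evalue w_large.
  move=> ok1T; apply: wp_skip; split=> //.
    have : 100 <= 2 ^ k * (200 * n + 200 * m + 100).
      by apply: (@leq_mul 1 100); [rewrite expn_gt0|exact: leq_addl].
    by move: t1le; rewrite expnS -mulnA; move: (2 ^ k * _) => X /=; lia.
  by exists true; rewrite r17 ok1T; split=> // _; exact: yes1.
move=> ok1F; apply: wp_seq; apply: (set_wp true) => _.
apply: wp_conseq.
  exact: (IH _ _ _ _ r161 (set_bit_canvas _ _ can1) (set_ok true _ hb1')).
move=> t2 rho2 M2 F2 [t2le r162 can2 hb2 [ok2 [r172 yes2 no2]]].
split=> //.
- move: t1le t2le; rewrite expnS -mulnA; move: (2 ^ k * _) => X /=; lia.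
- exact: relax hb2.
exists ok2; split=> // bits' hbits gd.
case bk : (bits' k).
  apply: no2 gd => j /andP[kj j8]; case: eqP => [->//|jk]; apply: hbits; lia.
case/negP: ok1F; apply: no1 gd => j /andP[kj j8].
by case: eqP => [->//|jk]; apply: hbits; lia.
Qed.

End Final.

Section WholeProgram.

Variables n m w : nat.
Hypothesis n_gt3 : 3 < n.
Hypothesis w_large : base n m + low n * stride n + 100 <= 2 ^ w.
Variables ea eb ec : nat -> nat.
Hypothesis edges_lt : forall i, i < m -> [/\ ea i < n, eb i < n & ec i < n].
Variable x : nat -> bool.
Hypothesis one_in_three :
  forall i, i < m -> x (ea i) + x (eb i) + x (ec i) = 1.

Lemma wp_colouring t rho M :
  stores_edges n m ea eb ec M -> (forall v j, v < n -> j < stride n -> M v j = 0) ->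
  wp n m w colouring_cmd
    (fun t1 rho1 M1 => exists r c,
       [/\ t1 <= t + (200 * 1000) * (n * n * n + n * m),
           forall v, v < n -> M1 (low n) v = c v,
           forall v, v < n -> c v < r.+2,
           forall i, i < m -> unique_max (c (ea i)) (c (eb i)) (c (ec i)) &
           2 ^ r.+2 <= n]) t rho M.
Proof.
move=> inp M0.
apply: wp_seq; apply: wp_conseq; first exact: (wp_solve n_gt3 w_large edges_lt _ inp M0).
move=> t1 rho1 M1 _ [t1le inp1 fr1 enc1] _.
apply: wp_seq; apply: wp_conseq.
  exact: (wp_analyse n_gt3 w_large _ inp1 fr1 enc1).
move=> t2 rho2 M2 _ [t2le r15 lay2] _.
apply: wp_seq; apply: wp_conseq.
  exact: (wp_rounds n_gt3 w_large edges_lt one_in_three _ r15 lay2).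
move=> t3 rho3 M3 _ [t3le [r [act [col [[r16 _ lay3 st rn] few]]]]] _.
have r_lt_n : r.+2 < n by apply: leq_trans rn; apply: ltn_expl.
have can3 : canvas n m ea eb ec act col M3.
  case: lay3 => l1 l2 l3 l4 l5; split=> // [v vn|v vn _]; last exact: l5.
  by rewrite l2.
apply: wp_seq; apply: wp_conseq.
  apply: (wp_search n_gt3 w_large edges_lt r_lt_n few (k := 8) (bits := xpredT)) can3 _ => //.
  by move=> j; lia.
move=> t4 rho4 M4 _ [t4le _ can4 _ [ok [_ yes no]]] _.
have [bits0 gd0] := winning_bits edges_lt one_in_three st.
have okT : ok.
  apply: (no bits0) => [j|]; first by lia.
  by apply/allP => i; rewrite mem_iota => /andP[_ im]; apply: gd0.
have [bits [gd sh]] := yes okT.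
apply: wp_conseq; first exact: (wp_output n_gt3 w_large _ sh).
move=> t5 rho5 M5 _ [t5le E]; exists r, (final_col n m ea eb ec act col r bits).
split=> //; last 1 first.
- move=> i im; move/allP: gd; apply; by rewrite mem_iota.
- have n_le : n <= n * n by rewrite leq_pmull //; lia.
  have n2_le : n * n <= n * n * n by rewrite leq_pmulr //; lia.
  have m_le : m <= n * m by rewrite leq_pmull //; lia.
  by move: t1le t2le t3le t4le t5le; rewrite (_ : 2 ^ 8 = 256) //; lia.
- move=> v vn; exact: (final_col_lt _ vn st).
Qed.

End WholeProgram.

(** * Input and output *)

(** The maximum over an edge with three distinct vertices is attained once exactly
    if one of the three values exceeds the other two. *)
Lemma unique_max_edge (T : finType) (a b c : T) (f : T -> nat) :
  a != b -> a != c -> b != c ->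
  (#|[set v in [set a; b; c] | f v == \max_(u in [set a; b; c]) f u]| == 1) =
  unique_max (f a) (f b) (f c).
Proof.
move=> ab ac bc; rewrite -setUA.
have aN : a \notin [set b] :|: [set c] by rewrite !inE negb_or ab ac.
have bN : b \notin [set c] by rewrite inE.
rewrite big_setU1 // big_setU1 // big_set1 /=.
set M := maxn (f a) _.
have -> : #|[set v in [set a] :|: ([set b] :|: [set c]) | f v == M]| =
    (f a == M) + ((f b == M) + (f c == M)).
  rewrite -sum1_card (eq_bigl (fun v => (v \in a |: (b |: [set c])) && (f v == M))).
    by rewrite big_mkcondr big_setU1 // big_setU1 // big_set1; do 3![case: eqP => _].
  by move=> v; rewrite inE.
rewrite /unique_max /M; lia.
Qed.

(** A listed triple with a repeated vertex would span a set of at most two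
    elements. *)
Lemma edge_neq n (e : triple n) : #|edge_of e| = 3 ->
  [/\ e.1.1 != e.1.2, e.1.1 != e.2 & e.1.2 != e.2].
Proof.
rewrite /edge_of => h; split; apply/eqP => E; move: h; rewrite E.
- by rewrite setUid cards2; case: (_ != _).
- by rewrite setUAC setUid cards2; case: (_ != _).
- by rewrite -setUA setUid cards2; case: (_ != _).
Qed.

Section Edges.

Variables (n : nat) (H : hypergraph 'I_n) (xs : seq (triple n)).
Hypothesis H3 : uniform 3 H.
Hypothesis listing : edge_listing H xs.

Definition first_of i := nth 0 [seq nat_of_ord e.1.1 | e <- xs] i.
Definition second_of i := nth 0 [seq nat_of_ord e.1.2 | e <- xs] i.
Definition third_of i := nth 0 [seq nat_of_ord e.2 | e <- xs] i.

Lemma size_listing : size xs = #|H|.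
Proof. by rewrite -(size_map (@edge_of n)) (perm_size listing) cardE. Qed.

Lemma edge_at i : i < size xs ->
  exists e : triple n, [/\ edge_of e \in H, first_of i = e.1.1,
    second_of i = e.1.2 & third_of i = e.2].
Proof.
move=> im; have e0 : triple n by case: (xs) im.
exists (nth e0 xs i); rewrite /first_of /second_of /third_of !(nth_map e0) //; split=> //.
by rewrite -mem_enum -(perm_mem listing) map_f // mem_nth.
Qed.

Lemma nth_input i : i < size xs ->
  [/\ nth 0 (input_data xs) (3 * i + 2) = first_of i,
      nth 0 (input_data xs) (3 * i + 3) = second_of i &
      nth 0 (input_data xs) (3 * i + 4) = third_of i].
Proof.
rewrite /input_data /first_of /second_of /third_of.
rewrite !(addnC (3 * i)) /=; elim: xs i => // e s IH [|i] //.
by rewrite mulnS => /IH; rewrite !addnS.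
Qed.

Lemma size_input : size (input_data xs) = 3 * size xs + 2.
Proof.
rewrite /= addn2 size_flatten /shape -map_comp; congr _.+2.
by elim: xs => //= e s ->; rewrite mulnS.
Qed.

Lemma input_le b a : n <= b -> size xs <= b -> nth 0 (input_data xs) a <= b.
Proof.
move=> nb mb; suff /all_nthP h : all (leq^~ b) (input_data xs).
  by case: (ltnP a (size (input_data xs))) => [/h //|/(nth_default 0)->].
rewrite /= nb mb /=; elim: xs => //= e s ->.
by rewrite !(leq_trans (ltnW (ltn_ord _)) nb).
Qed.

Lemma LO_colouring_unique_max k (c : 'I_n -> 'I_k) (f : nat -> nat) :
  (forall v : 'I_n, f v = c v) ->
  (LO_colouring H c <->
   forall i, i < size xs ->
     unique_max (f (first_of i)) (f (second_of i)) (f (third_of i))).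
Proof.
move=> fc; split=> [LO i /edge_at[e [eH -> -> ->]]|um e eH].
  have [ab ac bc] := edge_neq (H3 eH).
  by rewrite !fc -(unique_max_edge (fun v => c v)) //; apply/eqP/LO.
have : e \in [seq edge_of x | x <- xs] by rewrite (perm_mem listing) mem_enum.
case/mapP => x xin eE.
have [ab ac bc] : [/\ x.1.1 != x.1.2, x.1.1 != x.2 & x.1.2 != x.2].
  by apply: edge_neq; apply: H3; rewrite -eE.
have im : index x xs < size xs by rewrite index_mem.
apply/eqP; rewrite eE (unique_max_edge (fun v => c v)) // -!fc.
have := um _ im; rewrite /first_of /second_of /third_of.
by rewrite !(nth_map x) // nth_index.
Qed.

End Edges.

Lemma exec_set w r e s x : eval w s e = x ->
  exec w (SetReg r e) s (cost e).+1 (State (upd (reg s) r x) (ram s)).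
Proof. by move<-; constructor. Qed.

Lemma exec_setup n (xs : seq (triple n)) w (m := size xs) :
  base n m + low n * stride n + 100 <= 2 ^ w ->
  let s0 := initial_state xs in
  let rho := upd (upd (upd (upd (fun=> 0) 0 n) 1 m) 2 (base n m)) 3 (stride n) in
  exec w setup_cmd s0 18 (State rho (ram s0)) /\
  represents n m w rho (fun i j => ram s0 (addr n m i j)) (State rho (ram s0)).
Proof.
move=> big s0 rho.
have small x : x < 100 -> word w x = x by move=> x1; rewrite word_small //; lia.
have base_lt : base n m + low n < 2 ^ w by move: big; rewrite /low /stride; nia.
have stride_lt : stride n < 2 ^ w by move: big; rewrite /low /stride; nia.
have n_lt : n <= base n m by rewrite /base; lia.
have m_lt : m <= base n m by rewrite /base; lia.
have data_lt a : nth 0 (input_data xs) a < 2 ^ w.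
  by apply: leq_ltn_trans (input_le a n_lt m_lt) _; lia.
have small' y : y <= base n m -> word w y = y by move=> yb; rewrite word_small //; lia.
split.
  apply: (ExecSeq (t := 3) (t1 := 15)).
    by apply: (exec_set _ (x := n)) => /=; rewrite small.
  apply: (ExecSeq (t := 3) (t1 := 12)).
    by apply: (exec_set _ (x := m)) => /=; rewrite small.
  apply: (ExecSeq (t := 8) (t1 := 4)).
    have h1 : 3 * m <= base n m by rewrite /base; lia.
    have h2 : 3 * m + 2 <= base n m by rewrite /base; lia.
    apply: (exec_set _ (x := base n m)); rewrite /= /upd /= (small 2) // (small 3) //.
    by rewrite (small' (3 * m)) // (small' (3 * m + 2)) // small'.
  by apply: (exec_set _ (x := stride n)); rewrite /= /upd /= (small 8) // word_small.
split=> // r; rewrite /rho /upd; do ![case: ifP => _ //]; lia.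
Qed.

Theorem theorem1 :
  exists (P : cmd) (d C : nat),
    forall (n : nat) (H : hypergraph 'I_n) (xs : seq (triple n)) (w : nat),
      4 <= n ->
      uniform 3 H ->
      LO_colourable 2 H ->
      edge_listing H xs ->
      (n + #|H|) ^ d <= 2 ^ w ->
      exists (t : nat) (s : state) (k : nat) (c : 'I_n -> 'I_k),
        [/\ exec w P (initial_state xs) t s,
            t <= C * (n ^ 3 + n * #|H|),
            returns_colouring s c,
            LO_colouring H c &
            k <= trunc_log 2 n].
Proof.
(* All addresses are below a quadratic polynomial in [n] and [m]; the exponent 4
   absorbs its coefficients since [4 <= n + m]. *)
exists log_colouring_cmd, 4, (300 * 1000) => n H xs w n4 H3 [c0 LO0] listing.
rewrite -(size_listing listing); set m := size xs => big.
have w_large : base n m + low n * stride n + 100 <= 2 ^ w.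
  apply: leq_trans big; rewrite /base /low /stride.
  have Nn : n <= n + m := leq_addr m n.
  have N4 := leq_trans n4 Nn.
  have sq := leq_mul Nn Nn; have N_sq := leq_mul N4 (leqnn (n + m)).
  have sq16 := leq_mul N4 N4; have := leq_mul sq16 (leqnn ((n + m) * (n + m))).
  by rewrite !expnS expn0 muln1 mulnA; lia.
have edges_lt i : i < m ->
    [/\ first_of xs i < n, second_of xs i < n & third_of xs i < n].
  by move=> /(edge_at listing)[e [_ -> -> ->]]; rewrite !ltn_ord.
pose f0 v := if insub v is Some u then nat_of_ord (c0 u) else 0.
have f0E (v : 'I_n) : f0 v = c0 v by rewrite /f0 valK.
have um0 := (LO_colouring_unique_max H3 listing f0E).1 LO0.
pose x v := f0 v == 1.
have f0_le v : f0 v <= 1 by rewrite /f0; case: insub => // u; have := ltn_ord (c0 u).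
have one i : i < m -> x (first_of xs i) + x (second_of xs i) + x (third_of xs i) = 1.
  move=> /um0; rewrite /x /unique_max.
  move: (f0_le (first_of xs i)) (f0_le (second_of xs i)) (f0_le (third_of xs i)).
  by case: (f0 _) (f0 _) (f0 _) => [|[|?]] [|[|?]] [|[|?]].
have [E0 R0] := exec_setup w_large.
have inp : stores_edges n m (first_of xs) (second_of xs) (third_of xs)
    (fun i j => ram (initial_state xs) (addr n m i j)).
  by move=> i im; rewrite /addr eqxx /=; apply: nth_input.
have M0 v j : v < n -> j < stride n -> ram (initial_state xs) (addr n m v j) = 0.
  move=> vn jq; rewrite /addr ltn_eqF; last by rewrite /low; lia.
  by rewrite [ram _ _]nth_default // size_input /base; lia.
have [t1 [s1 [rho1 [M1 [E1 R1 _ [r [c [t1le out c_lt um rn]]]]]]]] :=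
  wp_colouring n4 w_large edges_lt one 18 inp M0 R0.
have cE (v : 'I_n) : c v = (inord (c v) : 'I_r.+2) by rewrite inordK // c_lt.
exists (18 + t1), s1, r.+2, (fun v => inord (c v)); split.
- exact: ExecSeq E0 E1.
- apply: leq_trans t1le _; rewrite !expnS expn0 muln1.
  have := leq_mul (leq_mul n4 n4) n4; nia.
- move=> v; rewrite -cE -out // -(rep_table R1) /addr ?eqxx //.
  by rewrite /valid eqxx /base; have := ltn_ord v; lia.
- exact/(LO_colouring_unique_max H3 listing cE).
- exact: trunc_log_max.
Qed.
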